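(* Let $k$ be a field, $\mathbf C$ a finite category with terminal object $\bar c$, and $\Sigma\colon\mathbf C\to\mathbf{SimpComp}$ a functor. Let $\mathcal{I}=I\circ\Sigma\colon\mathbf C^{\mathrm{op}}\to\mathbf{Alg}_k$ be the associated diagram of incidence algebras (with restriction maps). Then \[\mathrm{HH}^q_{\mathrm{GS}}(\mathcal{I},\mathcal{I})\cong\mathrm{H}^q(\Sigma(\bar c);k)\] for all $q\geq 0$, where the right side is simplicial cohomology.
   Context: $\mathbf{SimpComp}$ is the category of finite simplicial complexes and injective simplicial maps. For a finite simplicial complex $\Sigma$, its face poset $F(\Sigma)$ is the set of simplices ordered by inclusion, and $I(\Sigma)$ is the incidence algebra of $F(\Sigma)$: the $k$-vector space with basis the pairs $x\le y$ in $F(\Sigma)$, with product of basis elements equal to their composite when composable and $0$ otherwise. An injective simplicial map $\Sigma'\to\Sigma''$ identifies $F(\Sigma')$ with a lower ideal of $F(\Sigma'')$; the induced restriction map $I(\Sigma'')\to I(\Sigma')$ sends a basis element $x\le y$ to the corresponding basis element if $x,y$ lie in the image and to $0$ otherwise; this is a homological epimorphism, and $I\circ\Sigma$ is the resulting functor $\mathbf C^{\mathrm{op}}\to\mathbf{Alg}_k$. Diagrammatic Hochschild cohomology of a presheaf of algebras $\mathcal{A}\colon\mathbf C^{\mathrm{op}}\to\mathbf{Alg}_k$ with coefficients in itself: the cohomology of the total complex of the double complex $C^{p,q}=\prod_\sigma\mathrm{Hom}_k(\mathcal{A}(c_p)^{\otimes q},\mathcal{A}(c_0))$ over strings $\sigma=(c_0\to\cdots\to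 c_p)$ of composable morphisms, with Hochschild differential in $q$ and simplicial differential $(d\Gamma)^\sigma=\mathcal{A}(c_0\to c_1)\circ\Gamma^{\partial_0\sigma}+\sum_{r=1}^{p-1}(-1)^r\Gamma^{\partial_r\sigma}+(-1)^p\Gamma^{\partial_p\sigma}\circ\mathcal{A}(c_{p-1}\to c_p)^{\otimes q}$ in $p$ ($\partial_r$ deletes $c_r$). *)

(* Defs.v *)
From HB Require Import structures.
From mathcomp Require Import all_boot all_order all_algebra.
Set Implicit Arguments. Unset Strict Implicit. Unset Printing Implicit Defensive.
Import GRing.Theory.
Local Open Scope ring_scope.

(* [comp g f] is the composite g o f, meaningful when tgt f = src g.   *)
Record fincat := FinCat {
  Ob : finType;
  Mor : finType;
  src : Mor -> Ob;
  tgt : Mor -> Ob;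
  idm : Ob -> Mor;
  comp : Mor -> Mor -> Mor }.

Definition is_category (C : fincat) : Prop :=
  [/\ forall c : Ob C, src (idm c) = c /\ tgt (idm c) = c,
      forall f g : Mor C, tgt f = src g ->
        src (comp g f) = src f /\ tgt (comp g f) = tgt g,
      forall f : Mor C, comp f (idm (src f)) = f /\ comp (idm (tgt f)) f = f
    & forall f g h : Mor C, tgt f = src g -> tgt g = src h ->
        comp h (comp g f) = comp (comp h g) f].

Definition is_terminal (C : fincat) (t : Ob C) : Prop :=
  forall c : Ob C, exists! f : Mor C, src f = c /\ tgt f = t.

Definition is_simpcomp (V : finType) (S : {set {set V}}) : bool :=
  (set0 \notin S) &&
  [forall s in S, forall t : {set V}, ((t \subset s) && (t != set0)) ==> (t \in S)].

Definition verts (V : finType) (S : {set {set V}}) : {set V} := \bigcup_(s in S) s.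

Definition is_inj_simpmap (V : finType) (S S' : {set {set V}}) (F : V -> V) : Prop :=
  (forall s, s \in S -> F @: s \in S') /\ {in verts S &, injective F}.

Definition is_functor_SimpComp (C : fincat) (V : finType)
    (Sg : Ob C -> {set {set V}}) (Sm : Mor C -> V -> V) : Prop :=
  [/\ forall c, is_simpcomp (Sg c),
      forall f, is_inj_simpmap (Sg (src f)) (Sg (tgt f)) (Sm f),
      forall c, {in verts (Sg c), Sm (idm c) =1 id}
    & forall f g, tgt f = src g ->
        {in verts (Sg (src f)), Sm (comp g f) =1 Sm g \o Sm f}].

Definition induces_coh_iso (k : fieldType) (U U' : lmodType k)
    (Z B : U -> Prop) (Z' B' : U' -> Prop) (f : U -> U') : Prop :=
  [/\ forall x, Z x -> Z' (f x),
      forall x, B x -> B' (f x),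
      forall x, Z x -> B' (f x) -> B x
    & forall x', Z' x' -> exists2 x, Z x & B' (x' - f x)].

Section Cochains.
Variables (k : fieldType) (C : fincat) (V : finType)
  (Sg : Ob C -> {set {set V}}) (Sm : Mor C -> V -> V).

(* basis of incidence algebras: pairs (x, y) of simplices with x <= y *)
Definition Bas := ({set V} * {set V})%type.

Definition isbas (S : {set {set V}}) (b : Bas) : bool :=
  [&& b.1 \in S, b.2 \in S & b.1 \subset b.2].

(* product of basis elements: (x<=y)(y<=z) = (x<=z), else 0 (None) *)
Definition mulB (a b : Bas) : option Bas :=
  if a.2 == b.1 then Some (a.1, b.2) else None.

(* restriction I(Sg (tgt f)) -> I(Sg (src f)) on basis elements *)
Definition resB (f : Mor C) (b : Bas) : option Bas :=
  [pick a : Bas | isbas (Sg (src f)) a &&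
                  ((Sm f @: a.1, Sm f @: a.2) == b)].

(* strings c0 -f1-> c1 -> ... -fp-> cp, stored as (c0, [:: f1; ...; fp]) *)
Fixpoint chain (c : Ob C) (fs : seq (Mor C)) : bool :=
  if fs is f :: fs' then (src f == c) && chain (tgt f) fs' else true.

Fixpoint endp (c : Ob C) (fs : seq (Mor C)) : Ob C :=
  if fs is f :: fs' then endp (tgt f) fs' else c.

Definition resS (fs : seq (Mor C)) (b : Bas) : option Bas :=
  foldr (fun f ob => obind (resB f) ob) (Some b) fs.

(* G c0 fs as b = coefficient of b in Gamma^(c0,fs)(a_1 (x) ... (x) a_q) *)
Definition cofun := Ob C -> seq (Mor C) -> seq Bas -> Bas -> k.

Definition dsimp (G : cofun) (c0 : Ob C) (fs : seq (Mor C)) (as_ : seq Bas)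
    (b : Bas) : k :=
  if fs is f1 :: fs' then
    let p := size fs in
    (\sum_(b' : Bas | isbas (Sg (tgt f1)) b' && (resB f1 b' == Some b))
        G (tgt f1) fs' as_ b')
    + (\sum_(1 <= r < p) (-1) ^+ r *
        G c0 (take r.-1 fs ++ comp (nth f1 fs r) (nth f1 fs r.-1) :: drop r.+1 fs)
          as_ b)
    + (-1) ^+ p *
        (let ras := map (resB (last f1 fs')) as_ in
         if all (fun o => o != None) ras then G c0 (belast f1 fs') (pmap id ras) b
         else 0)
  else 0.

(* Hochschild differential (bimodule structure via resS), on q >= 1 inputs *)
Definition hoch (G : cofun) (c0 : Ob C) (fs : seq (Mor C)) (as_ : seq Bas)
    (b : Bas) : k :=
  if as_ is a1 :: as' then
    let q := size as_ in
    (if resS fs a1 is Some e then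
       \sum_(b' : Bas | isbas (Sg c0) b' && (mulB e b' == Some b)) G c0 fs as' b'
     else 0)
    + (\sum_(1 <= i < q) (-1) ^+ i *
        (if mulB (nth a1 as_ i.-1) (nth a1 as_ i) is Some c then
           G c0 fs (take i.-1 as_ ++ c :: drop i.+1 as_) b
         else 0))
    + (-1) ^+ q *
        (if resS fs (last a1 as') is Some e then
           \sum_(b' : Bas | isbas (Sg c0) b' && (mulB b' e == Some b))
             G c0 fs (belast a1 as') b'
         else 0)
  else 0.

Definition Dfun (G : cofun) (c0 : Ob C) (fs : seq (Mor C)) (as_ : seq Bas)
    (b : Bas) : k :=
  dsimp G c0 fs as_ b + (-1) ^+ (size fs) * hoch G c0 fs as_ b.

Definition TIdx (n : nat) :=
  {p : 'I_n.+1 & ((p.-tuple (Mor C)) * ((n - p).-tuple Bas))%type}.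

Definition decode (n : nat) (x : Ob C * Bas * TIdx n)
    : Ob C * seq (Mor C) * seq Bas * Bas :=
  (x.1.1, val (tagged x.2).1, val (tagged x.2).2, x.1.2).

Definition validD (d : Ob C * seq (Mor C) * seq Bas * Bas) : bool :=
  let: (c0, fs, as_, b) := d in
  [&& chain c0 fs, all (isbas (Sg (endp c0 fs))) as_ & isbas (Sg c0) b].

Definition Idx (n : nat) := {x : Ob C * Bas * TIdx n | validD (decode x)}.

(* total cochains of degree n:
   prod_{p+q=n} prod_sigma Hom_k(I(cp)^{(x)q}, I(c0)) in coordinates *)
Definition Cochains (n : nat) := {ffun Idx n -> k^o}.

Definition ev (n : nat) (x : Cochains n) : cofun :=
  fun c0 fs as_ b =>
    if [pick i : Idx n | decode (val i) == (c0, fs, as_, b)] is Some i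
    then x i else 0.

Definition Dtot (n : nat) (x : Cochains n) : Cochains n.+1 :=
  [ffun i : Idx n.+1 =>
     let: (c0, fs, as_, b) := decode (val i) in Dfun (ev x) c0 fs as_ b].

Definition isCocycle (n : nat) (x : Cochains n) : Prop := Dtot x = 0.

Definition isCobound (n : nat) : Cochains n -> Prop :=
  match n with
  | 0 => fun x => x = 0
  | n'.+1 => fun x => exists y : Cochains n', Dtot y = x
  end.

End Cochains.

(* Simplicial cochains of a complex S with coefficients in k; the      *)
(* vertices of a simplex are ordered by the enumeration order of V.    *)
Section Simplicial.
Variables (k : fieldType) (V : finType) (S : {set {set V}}).

Definition SIdx (q : nat) := {s : {set V} | (s \in S) && (#|s| == q.+1)}.

Definition SCochains (q : nat) := {ffun SIdx q -> k^o}.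

Definition sev (q : nat) (x : SCochains q) : {set V} -> k :=
  fun s => if [pick i : SIdx q | val i == s] is Some i then x i else 0.

Definition sdelta (q : nat) (x : SCochains q) : SCochains q.+1 :=
  [ffun i : SIdx q.+1 =>
     \sum_(v <- enum (val i)) (-1) ^+ (index v (enum (val i))) * sev x (val i :\ v)].

Definition isSCocycle (q : nat) (x : SCochains q) : Prop := sdelta x = 0.

Definition isSCobound (q : nat) : SCochains q -> Prop :=
  match q with
  | 0 => fun x => x = 0
  | q'.+1 => fun x => exists y : SCochains q', sdelta y = x
  end.

End Simplicial.

(* Main.v *)
Require Import Defs.
From HB Require Import structures.
From mathcomp Require Import all_boot all_order all_algebra.
From mathcomp Require Import ring.

(* Fix a string of arrows c_0 -> ... -> c_p.  The bar complex splits into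
   composable and non-composable tensors; inserting an idempotent at the first
   gap contracts the non-composable part.  A composable tensor whose end points
   come from Sigma(c_0) is a weak flag x_0 <= ... <= x_q of simplices of
   Sigma(c_0), because Sigma(c_0) is a lower ideal of Sigma(c_p); so what remains
   no longer depends on c_p, and appending the arrow c_p -> cbar contracts it onto
   the cochains of the order complex of the face poset of Sigma(cbar).
   These are compared with the simplicial cochains through the double complex of
   pairs (s; x_0 <= ... <= x_q) with s contained in x_0: for a fixed flag it is
   contracted by coning off a vertex of x_0, for a fixed s by putting s in front
   of the flag. *)

Set Implicit Arguments. Unset Strict Implicit. Unset Printing Implicit Defensive.
Import GRing.Theory.
Local Open Scope ring_scope.

(** * Order complex of the face poset and simplicial cochains *)

(** The isomorphism must be induced by one linear map defined on every cochain, cocycle or not. So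
    the passage from flags to simplices is an explicit recursion ([colp], hence [subdiv]), linear in
    its argument; the contraction in the other direction only has to produce preimages and stays an
    existence statement ([row_prim]). Neither contraction commutes with the differential of the
    other direction, so each primitive is corrected recursively, along the size of the simplex or
    the length of the flag. Repeated members of a flag are kept: the tensors are not normalised, and
    putting [s] in front of a flag may repeat [s]. Cochains are handled as ungraded functions of
    lists and sets. This is harmless because a value of the differential only reads valid indices
    one degree lower, on the same side of the composable/non-composable splitting; degrees return
    with the coordinates. The total homotopy is applied to cocycles only, where one half of the
    homotopy identity vanishes. *)

Section AlternatingDeletion.
Variable k : fieldType.

(** Splitting at the head, deleted or kept, turns the square-zero and commutation rules into plain
    inductions. The same operator serves the vertices of a simplex and the members of a flag. *)
Fixpoint altdel (T : Type) (g : seq T -> k) (l : seq T) : k :=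
  if l is x :: l' then g l' - altdel (fun m => g (x :: m)) l' else 0.

Lemma eq_altdel (T : eqType) (g h : seq T -> k) l :
    (forall m, subseq m l -> (size m).+1 = size l -> g m = h m) ->
  altdel g l = altdel h l.
Proof.
elim: l g h => [//|x l IH] g h e /=; congr (_ - _).
  by apply: e => //; apply: subseq_cons.
by apply: IH => m sm em; apply: e => /=; rewrite ?eqxx ?em.
Qed.

Lemma altdelZD (T : Type) a (g h : seq T -> k) l :
  altdel (fun m => a * g m + h m) l = a * altdel g l + altdel h l.
Proof.
elim: l g h => [|x l IH] g h /=; first by rewrite mulr0 addr0.
by rewrite IH; ring.
Qed.

Lemma altdel0 (T : Type) (l : seq T) : altdel (fun=> 0 : k) l = 0.
Proof. by elim: l => [//|x l IH] /=; rewrite IH subr0. Qed.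

Lemma altdel_map (T U : Type) (f : U -> T) (g : seq T -> k) l :
  altdel g (map f l) = altdel (fun m => g (map f m)) l.
Proof. by elim: l g => [//|x l IH] g /=; rewrite IH. Qed.

Lemma altdelK (T : eqType) (g : seq T -> k) l : altdel (altdel g) l = 0.
Proof.
elim: l g => [//|x l IH] g /=.
rewrite [X in _ - X](@eq_altdel _ _ (fun m => -1 * altdel (fun m => g (x :: m)) m + g m)).
  by rewrite altdelZD IH; ring.
by move=> m _ _; ring.
Qed.

Lemma altdelC (T U : eqType) (g : seq T -> seq U -> k) l m :
  altdel (fun a => altdel (g a) m) l = altdel (fun b => altdel (g^~ b) l) m.
Proof.
elim: l g => [|x l IH] g /=; first by rewrite altdel0.
rewrite (IH (fun a => g (x :: a))).
rewrite (@eq_altdel _ (fun b => g l b - _)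
  (fun b => -1 * altdel (fun a => g (x :: a) b) l + g l b)).
  by rewrite altdelZD; ring.
by move=> b _ _; ring.
Qed.

Lemma altdel_sum (T : eqType) (g : seq T -> k) l : uniq l ->
  \sum_(v <- l) (-1) ^+ index v l * g (rem v l) = altdel g l.
Proof.
elim: l g => [|x l IH] g /=; first by rewrite big_nil.
case/andP=> xl ul; rewrite big_cons /= eqxx expr0 mul1r; congr (_ + _).
rewrite -(IH (fun m => g (x :: m)) ul) -sumrN.
apply: eq_big_seq => v vl; have /negPf nvx : x != v by apply: contraNneq xl => ->.
by rewrite nvx exprS; ring.
Qed.

End AlternatingDeletion.

(** * Simplicial coboundary, augmented by the empty simplex *)

Section Boundary.
Variables (k : fieldType) (V : finType).
Implicit Types (s x : {set V}) (v w : V) (y z : {set V} -> k).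

Lemma enum_setE s : enum s = [seq v <- enum V | v \in s].
Proof. by rewrite [in RHS]enumT. Qed.

(** Enumerations of sets are filtered from that of [V], so deleting from the list and deleting from
    the set agree, with the same signs. *)
Lemma enum_set_subseq l s : subseq l (enum s) -> enum [set:: l] = l.
Proof.
move=> ls; have lV : subseq l (enum V).
  by apply: subseq_trans ls _; rewrite enum_setE filter_subseq.
rewrite enum_setE [RHS](elimT (subseq_uniqP (enum_uniq V)) lV).
by apply: eq_filter => v; rewrite inE.
Qed.

(** At a vertex this is the value of [y] at [set0]; hence the conditions of vanishing at [set0]
    imposed on cochains below. *)
Definition bd y s : k := altdel (fun l => y [set:: l]) (enum s).

Lemma bdE y s :
  bd y s = \sum_(v <- enum s) (-1) ^+ index v (enum s) * y (s :\ v).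
Proof.
rewrite /bd -altdel_sum ?enum_uniq //; apply: eq_bigr => v _; congr (_ * y _).
by apply/setP=> w; rewrite !inE mem_rem_uniq ?enum_uniq // !inE mem_enum.
Qed.

Lemma eq_bd y z s :
    (forall t : {set V}, t \subset s -> #|t|.+1 = #|s| -> y t = z t) -> bd y s = bd z s.
Proof.
move=> e; apply: eq_altdel => m ms em; apply: e.
  by apply/subsetP=> v; rewrite inE => /(mem_subseq ms); rewrite mem_enum.
by rewrite cardE (enum_set_subseq ms) em -cardE.
Qed.

Lemma bdZD a y z s : bd (fun t => a * y t + z t) s = a * bd y s + bd z s.
Proof. exact: altdelZD. Qed.

Lemma bd0 s : bd (fun=> 0) s = 0. Proof. exact: altdel0. Qed.

Lemma bd_set0 y : bd y set0 = 0.
Proof. by rewrite /bd enum_set0. Qed.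

Lemma bdK y s : bd (bd y) s = 0.
Proof.
rewrite -[RHS](altdelK (fun l => y [set:: l]) (enum s)); apply: eq_altdel => m ms _.
by rewrite /bd (enum_set_subseq ms).
Qed.

Lemma bd_altdelC (T : eqType) (y : {set V} -> seq T -> k) s l :
  bd (fun t => altdel (y t) l) s = altdel (fun m => bd (y^~ m) s) l.
Proof. exact: altdelC. Qed.

Definition cone v y s : k := if v \in s then 0 else y (v |: s).

(* The simplicial cochains of the full simplex on [x] are contracted by coning
   off the first vertex of [x]. *)
Lemma bd_cone v r x y s : enum x = v :: r -> s \subset x ->
  cone v (bd y) s + bd (cone v y) s = y s.
Proof.
move=> ex sx; have vr : v \notin r by have := enum_uniq x; rewrite ex => /= /andP[].
have ss : subseq (enum s) (enum x).
  rewrite !enum_setE.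
  have -> : [seq w <- enum V | w \in s] = [seq w <- [seq w <- enum V | w \in x] | w \in s].
    rewrite -filter_predI; apply: eq_filter => w /=.
    by case: (boolP (w \in s)) => // /(subsetP sx) ->.
  exact: filter_subseq.
rewrite /cone /bd; case: (boolP (v \in s)) => [vs|vs].
  have [l es] : exists l, enum s = v :: l.
    have : v \in enum s by rewrite mem_enum.
    move: ss; rewrite ex; case: (enum s) => [//|w l] /=.
    case: eqVneq => [->|nw] ss; first by exists l.
    by move/(mem_subseq ss); rewrite (negPf vr).
  have vl : v \notin l by have := enum_uniq s; rewrite es => /= /andP[].
  rewrite es /= inE (negPf vl) add0r (@eq_altdel _ _ _ (fun=> 0)).
    rewrite altdel0 subr0; congr y; apply/setP=> w.
    by rewrite -[in RHS]mem_enum es !inE.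
  by move=> m _ _; rewrite !inE eqxx.
(* As [v] comes first in the enumeration of [x], adding it to [s] puts it at the head and creates no
   sign. *)
have -> : enum (v |: s) = v :: enum s.
  have -> : v |: s = [set:: v :: enum s] by apply/setP=> w; rewrite !inE mem_enum.
  apply: (@enum_set_subseq _ x); rewrite ex /= eqxx.
  have : v \notin enum s by rewrite mem_enum.
  move: ss; rewrite ex; case: (enum s) => [|w l] /=; first by rewrite sub0seq.
  by rewrite inE; case: eqVneq.
rewrite /= [X in _ - _ + X](@eq_altdel _ _ _ (fun m => y [set:: v :: m])); last first.
  move=> m ms _; rewrite inE; have /negPf -> : v \notin m.
    by apply: contra vs => /(mem_subseq ms); rewrite mem_enum.
  by congr y; apply/setP=> w; rewrite !inE.
by rewrite subrK; congr y; apply/setP=> w; rewrite inE mem_enum.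
Qed.

End Boundary.

(** * The double complex of simplices and flags *)

Section Subdivision.
Variables (k : fieldType) (V : finType) (S : {set {set V}}).
Hypothesis HS : is_simpcomp S.
Implicit Types (s t x : {set V}) (xs l : seq {set V}).
Implicit Types (y z u : {set V} -> seq {set V} -> k) (zeta xi eta : seq {set V} -> k).

Definition sub_rel : rel {set V} := fun s t => s \subset t.

Definition flag xs := sorted sub_rel xs && all (mem S) xs.

(* Indices of the double complex comparing flags and simplices; the empty set
   and the empty flag give the two augmentations. *)
Definition bisimp s xs :=
  [&& (s == set0) || (s \in S), flag xs & all (sub_rel s) xs].

Lemma sub_rel_trans : transitive sub_rel.
Proof. by move=> t s x; apply: subset_trans. Qed.

Lemma simp_neq0 s : s \in S -> s != set0.
Proof. by case/andP: HS => S0 _ sS; apply: contraNneq S0 => <-. Qed.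

Lemma simp_sub s t : s \in S -> t \subset s -> t != set0 -> t \in S.
Proof.
case/andP: HS => _ /forall_inP h sS ts t0.
by have /forallP/(_ t) := h s sS; rewrite ts t0.
Qed.

Lemma bisimp_subseq s xs l : subseq l xs -> bisimp s xs -> bisimp s l.
Proof.
move=> sl /and3P[s0 /andP[so al] ss]; apply/and3P; split=> //.
  rewrite /flag (subseq_sorted sub_rel_trans sl so) /=.
  by apply/allP=> x /(mem_subseq sl) /(allP al).
by apply/allP=> x /(mem_subseq sl) /(allP ss).
Qed.

Lemma bisimp_sub s t xs : t \subset s -> bisimp s xs -> bisimp t xs.
Proof.
move=> ts /and3P[s0 fl ss]; apply/and3P; split=> //; last first.
  by apply/allP=> x /(allP ss); apply: subset_trans.
case: (eqVneq t set0) => //= t0; case/orP: s0 => [/eqP s0|sS].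
  by move: ts; rewrite s0 subset0 (negPf t0).
exact: simp_sub sS ts t0.
Qed.

Lemma bisimp_cons s xs : s \in S -> bisimp s xs -> bisimp s (s :: xs).
Proof.
move=> sS /and3P[_ /andP[so al] ss]; apply/and3P; split; rewrite ?sS ?orbT //=.
  by rewrite /flag /= sS al andbT path_sortedE ?so ?andbT //; apply: sub_rel_trans.
by rewrite ss andbT /sub_rel.
Qed.

Lemma bisimp_cone v s x xs : v \in x -> bisimp s (x :: xs) -> bisimp (v |: s) (x :: xs).
Proof.
move=> vx /and3P[s0 fl ss].
have vsx : v |: s \subset x by rewrite subUset sub1set vx; case/andP: ss.
have xS : x \in S by case/and3P: fl.
apply/and3P; split=> //.
  apply/orP; right; apply: simp_sub xS vsx _.
  by apply/set0Pn; exists v; rewrite setU11.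
rewrite /= {1}/sub_rel vsx /=.
case/andP: fl => /= so _; move: so; rewrite path_sortedE; last exact: sub_rel_trans.
by case/andP=> /allP h _; apply/allP=> t /h; apply: subset_trans.
Qed.

Lemma bisimp_flag s xs : bisimp s xs -> flag xs.
Proof. by case/and3P. Qed.

Lemma bisimp0 xs : flag xs -> bisimp set0 xs.
Proof.
by move=> fl; apply/and3P; split; rewrite ?eqxx //; apply/allP=> x _; apply: sub0set.
Qed.

Lemma bisimp_nil s : s \in S -> bisimp s [::].
Proof. by move=> sS; rewrite /bisimp sS orbT. Qed.

(** The sign makes the two directions anticommute; see [bd_sign]. *)
Definition tdiff y s xs : k := bd (y^~ xs) s + (-1) ^+ #|s| * altdel (y s) xs.

Lemma eq_tdiff y z s xs :
    (forall t l, t \subset s -> subseq l xs ->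
       (#|t| + size l).+1 = (#|s| + size xs)%N -> y t l = z t l) ->
  tdiff y s xs = tdiff z s xs.
Proof.
move=> e; congr (_ + _ * _).
  by apply: eq_bd => t ts et; apply: e; rewrite ?subseq_refl // -et.
by apply: eq_altdel => l ls el; apply: e; rewrite // -el addnS.
Qed.

Lemma tdiffZD a y z s xs :
  tdiff (fun t l => a * y t l + z t l) s xs = a * tdiff y s xs + tdiff z s xs.
Proof. by rewrite /tdiff bdZD altdelZD; ring. Qed.

Lemma tdiffB y z s xs :
  tdiff (fun t l => y t l - z t l) s xs = tdiff y s xs - tdiff z s xs.
Proof.
transitivity (tdiff (fun t l => -1 * z t l + y t l) s xs).
  by apply: eq_tdiff => t l _ _ _; ring.
by rewrite tdiffZD; ring.
Qed.

Lemma tdiff0 s xs : tdiff (fun _ _ => 0) s xs = 0.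
Proof. by rewrite /tdiff bd0 altdel0 mulr0 addr0. Qed.

Lemma bd_sign y s l :
  bd (fun t => (-1) ^+ #|t| * y t l) s = - ((-1) ^+ #|s| * bd (y^~ l) s).
Proof.
transitivity (bd (fun t => - (-1) ^+ #|s| * y t l + 0) s).
  by apply: eq_bd => t _ <-; rewrite exprS; ring.
by rewrite bdZD bd0; ring.
Qed.

Lemma signK n : (-1) ^+ n * (-1) ^+ n = 1 :> k.
Proof. by rewrite -exprD addnn -muln2 exprM sqrr_sign. Qed.

Lemma tdiffK y s xs : tdiff (tdiff y) s xs = 0.
Proof.
have e1 : bd ((tdiff y)^~ xs) s = - ((-1) ^+ #|s| * altdel (fun m => bd (y^~ m) s) xs).
  transitivity (bd (fun t => 1 * bd (y^~ xs) t + (-1) ^+ #|t| * altdel (y t) xs) s).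
    by apply: eq_bd => t _ _; rewrite /tdiff; ring.
  by rewrite bdZD bdK (@bd_sign (fun t m => altdel (y t) m)) bd_altdelC; ring.
have e2 : altdel (tdiff y s) xs = altdel (fun m => bd (y^~ m) s) xs.
  transitivity (altdel (fun m => (-1) ^+ #|s| * altdel (y s) m + bd (y^~ m) s) xs).
    by apply: eq_altdel => m _ _; rewrite /tdiff; ring.
  by rewrite altdelZD altdelK; ring.
by rewrite /tdiff e1 -/(tdiff y) e2; ring.
Qed.

(* Primitive of a cocycle vanishing on flags, obtained from the contraction
   that puts [s] in front of the flag. *)
Fixpoint col_prim n y s xs : k :=
  if n is n'.+1 then
    if s == set0 then 0 else
    (-1) ^+ #|s| * (y s (s :: xs) - bd (fun t => col_prim n' y t (s :: xs)) s)
  else 0.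

(** The number is fuel for a recursion through proper faces; its irrelevance gives the unfolding
    [colpE]. *)
Lemma col_prim_stable n m y s xs : (#|s| <= n)%N -> (#|s| <= m)%N ->
  col_prim n y s xs = col_prim m y s xs.
Proof.
elim: n m s xs => [|n IH] [|m] s xs //=; rewrite ?leqn0 ?cards_eq0; try by move->.
  by move=> _ ->.
case: ifP => // _ sn sm; congr (_ * (_ - _)).
by apply: eq_bd => t _ ct; apply: IH; rewrite -ltnS ct.
Qed.

Definition colp y s xs := col_prim #|s| y s xs.

Lemma colpE y s xs : colp y s xs =
  if s == set0 then 0 else
  (-1) ^+ #|s| * (y s (s :: xs) - bd (fun t => colp y t (s :: xs)) s).
Proof.
rewrite /colp; case e: #|s| => [|n] /=; first by move/eqP: e; rewrite cards_eq0 => ->.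
case: ifP => // _; rewrite e; congr (_ * (_ - _)); apply: eq_bd => t _ ct.
by apply: col_prim_stable; rewrite // -ltnS ct e.
Qed.

Lemma colp_set0 y xs : colp y set0 xs = 0.
Proof. by rewrite colpE eqxx. Qed.

Lemma colpZD a u y z s xs : (forall t l, u t l = a * y t l + z t l) ->
  colp u s xs = a * colp y s xs + colp z s xs.
Proof.
move=> e; have [n] := ubnP #|s|; elim: n s xs => [//|n IH] s xs sn.
rewrite !(colpE _ s); case: ifP => _; first by rewrite mulr0 addr0.
rewrite (@eq_bd _ _ _ (fun t => a * colp y t (s :: xs) + colp z t (s :: xs))).
  by rewrite bdZD e; ring.
by move=> t _ ct; apply: IH; rewrite -ltnS in sn; rewrite -ct in sn.
Qed.

Lemma colp_degree m y :
    (forall s xs, bisimp s xs -> (#|s| + size xs)%N = m.+1 -> y s xs = 0) ->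
  forall s xs, bisimp s xs -> (#|s| + size xs)%N = m -> colp y s xs = 0.
Proof.
move=> y0 s; have [n] := ubnP #|s|; elim: n s => [//|n IH] s sn xs bs e.
rewrite colpE; case: ifP => // /negbT s0.
have sS : s \in S by case/and3P: bs; rewrite (negPf s0).
have bss := bisimp_cons sS bs.
rewrite y0 //; last by rewrite /= addnS e.
rewrite (@eq_bd _ _ _ (fun=> 0)) ?bd0 ?subrr ?mulr0 // => t ts ct.
apply: IH; rewrite -?ct ?ltnS // in sn *; first exact: bisimp_sub bss.
by rewrite -e -ct addSnnS.
Qed.

(** Let [e] be what the faces of [s] leave over of [y s]. Since [u s] is [e] with [s] put in front,
    [tdiff u] equals [y] up to [altdel e (s :: xs)]. This error vanishes because [y] is closed and
    [u] is already a primitive on the faces of [s], along the flag [s :: xs]. *)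
Lemma colp_tdiff y :
    (forall s xs, bisimp s xs -> tdiff y s xs = 0) ->
    (forall xs, flag xs -> y set0 xs = 0) ->
  forall s xs, bisimp s xs -> tdiff (colp y) s xs = y s xs.
Proof.
move=> yc y0 s; have [n] := ubnP #|s|; elim: n s => [//|n IH] s sn xs bs.
case: (eqVneq s set0) => [s0|s0].
  rewrite s0 in bs *; rewrite y0 ?(bisimp_flag bs) // /tdiff bd_set0 add0r.
  rewrite (@eq_altdel _ _ _ (fun=> 0)) ?altdel0 ?mulr0 // => m _ _; exact: colp_set0.
have sS : s \in S by case/and3P: bs; rewrite (negPf s0).
have bss := bisimp_cons sS bs.
set u := colp y; pose e l := y s l - bd (u^~ l) s.
have uE l : u s l = (-1) ^+ #|s| * e (s :: l) by rewrite /u colpE (negPf s0).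
have du : altdel (u s) xs = (-1) ^+ #|s| * (e xs - altdel e (s :: xs)).
  transitivity (altdel (fun l => (-1) ^+ #|s| * e (s :: l) + 0) xs).
    by apply: eq_altdel => l _ _; rewrite uE; ring.
  by rewrite altdelZD altdel0 /=; ring.
suff de : altdel e (s :: xs) = 0.
  by rewrite /tdiff du de subr0 mulrA signK /e; ring.
have := yc _ _ bss; rewrite /tdiff => yc'.
have h : bd (fun t => altdel (u t) (s :: xs)) s =
         - ((-1) ^+ #|s| * bd (y^~ (s :: xs)) s).
  transitivity (bd (fun t => (-1) ^+ #|t| * (- 1 * bd (u^~ (s :: xs)) t + y t (s :: xs))) s).
    apply: eq_bd => t ts ct; have tn : (#|t| < n)%N by rewrite -ltnS ct.
    rewrite -(IH t tn _ (bisimp_sub ts bss)) /tdiff.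
    by rewrite mulrDr mulrDr [X in _ + (_ + X)]mulrA signK; ring.
  by rewrite (@bd_sign (fun t l => -1 * bd (u^~ l) t + y t l)) bdZD bdK; ring.
have -> : altdel e (s :: xs) = altdel (y s) (s :: xs) - bd (fun t => altdel (u t) (s :: xs)) s.
  transitivity (altdel (fun l => -1 * bd (u^~ l) s + y s l) (s :: xs)).
    by apply: eq_altdel => l _ _; rewrite /e; ring.
  by rewrite altdelZD bd_altdelC; ring.
have -> : altdel (y s) (s :: xs) = - ((-1) ^+ #|s| * bd (y^~ (s :: xs)) s).
  have /eqP := congr1 (fun a => (-1) ^+ #|s| * a) yc'.
  by rewrite mulr0 mulrDr mulrA signK mul1r addrC addr_eq0 => /eqP.
by rewrite h subrr.
Qed.

#[local] Arguments altdel : simpl never.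

(* Primitive of a cocycle vanishing on simplices, obtained by coning off the
   first vertex of the smallest member of the flag. *)
Lemma row_prim y :
    (forall s xs, bisimp s xs -> tdiff y s xs = 0) ->
    (forall s, bisimp s [::] -> y s [::] = 0) ->
  exists2 u, forall s, u s [::] = 0
    & forall s xs, bisimp s xs -> tdiff u s xs = y s xs.
Proof.
move=> yc y0.
(* Deleting the head [x] changes the vertex to be coned off, so the cone does not commute with
   [altdel]; the correction term recurses on shorter flags, with [n] bounding their length. *)
pose fix u (n : nat) s xs {struct n} : k := if n is n'.+1 then if xs is x :: _ then
    if enum x is v :: _ then
      cone v (fun t => y t xs - (-1) ^+ #|t| * altdel (u n' t) xs) s
    else 0 else 0 else 0.
have u_nil n s : u n s [::] = 0 by case: n.
have u_stable : forall n m s xs, (size xs <= n)%N -> (size xs <= m)%N -> u n s xs = u m s xs.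
  elim=> [|n IH] [|m] s [|x xs] //= sn sm; case: (enum x) => // v _.
  rewrite /cone; case: ifP => // _; congr (_ - _ * _).
  by apply: eq_altdel => l _ [el]; apply: IH; rewrite el.
exists (fun s xs => u (size xs) s xs) => [s|s xs]; first exact: u_nil.
have [n] := ubnP (size xs); elim: n s xs => [//|n IH] s xs sn bs.
pose w t l := u (size l) t l; rewrite -/w.
case: xs => [|x xs] in sn bs *.
  rewrite y0 // /tdiff /altdel mulr0 addr0 (@eq_bd _ _ _ (fun=> 0)) ?bd0 // => t _ _.
have xS : x \in S by case/and3P: (bisimp_flag bs).
case ex : (enum x) => [|v r].
  by have := simp_neq0 xS; rewrite -card_gt0 cardE ex.
pose e t l := y t l - (-1) ^+ #|t| * altdel (w t) l.
have wE t : w t (x :: xs) = cone v (e^~ (x :: xs)) t.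
  rewrite {1}/w /= ex /cone; case: ifP => // _; congr (_ - _ * _).
  apply: eq_altdel => l _ [el]; rewrite /w; apply: u_stable; by rewrite // el.
have vx : v \in x by rewrite -mem_enum ex mem_head.
have sx : s \subset x by case/and3P: bs => _ _ /andP[].
have := bd_cone (e^~ (x :: xs)) ex sx.
rewrite -(@eq_bd _ _ (w^~ (x :: xs))) => [|t _ _]; last exact: wE.
(* By [bd_cone] the error is the coned coboundary of [e]; it vanishes because [y] is closed and the
   induction hypothesis holds on the flags with one member deleted. *)
suff -> : cone v (bd (e^~ (x :: xs))) s = 0.
  by rewrite add0r /tdiff => ->; rewrite /e; ring.
rewrite /cone; case: ifP => // _.
set t := v |: s; have bt : bisimp t (x :: xs) by apply: bisimp_cone.
transitivity (bd (fun r => - ((-1) ^+ #|r| * altdel (w r) (x :: xs)) + y r (x :: xs)) t).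
  by apply: eq_bd => q _ _; rewrite /e; ring.
transitivity (- bd (fun r => (-1) ^+ #|r| * altdel (w r) (x :: xs)) t + bd (y^~ (x :: xs)) t).
  rewrite -[X in X + _]mulN1r -bdZD; apply: eq_bd => q _ _; ring.
rewrite (@bd_sign (fun t l => altdel (w t) l)) bd_altdelC opprK.
have -> : bd (y^~ (x :: xs)) t = - ((-1) ^+ #|t| * altdel (y t) (x :: xs)).
  by apply/eqP; rewrite -addr_eq0; apply/eqP; apply: yc.
have -> : altdel (y t) (x :: xs) =
    altdel (fun l => (-1) ^+ #|t| * altdel (w t) l + bd (w^~ l) t) (x :: xs).
  apply: eq_altdel => l ls [el]; rewrite addrC -/(tdiff w t l); apply/esym.
  by apply: IH; [rewrite el | apply: bisimp_subseq bt].
by rewrite altdelZD altdelK; ring.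
Qed.

(** The two augmentations, cochains of flags and cochains of simplices, extended by zero to the
    double complex. *)
Definition at_empty xi s xs : k := if s == set0 then xi xs else 0.
Definition at_nil (w : {set V} -> k) s xs : k := if xs is [::] then w s else 0.

(** For a cocycle [xi], [tdiff (at_empty xi)] is closed and vanishes at the empty simplex;
    subtracting its primitive gives a cocycle of the double complex that restricts to [xi]. The
    formula is linear and defined for every [xi]. *)
Definition flag_lift xi s xs := at_empty xi s xs - colp (tdiff (at_empty xi)) s xs.

(* On cochains of the order complex of the face poset this is restriction
   along barycentric subdivision, up to signs. *)
Definition subdiv xi s := flag_lift xi s [::].

Lemma tdiff_at_empty xi xs : tdiff (at_empty xi) set0 xs = altdel xi xs.
Proof.
rewrite /tdiff bd_set0 cards0 add0r mul1r; apply: eq_altdel => l _ _.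
by rewrite /at_empty eqxx.
Qed.

Lemma subdivZD a zeta xi eta s : (forall l, zeta l = a * xi l + eta l) ->
  subdiv zeta s = a * subdiv xi s + subdiv eta s.
Proof.
move=> e; have atE t l : at_empty zeta t l = a * at_empty xi t l + at_empty eta t l.
  by rewrite /at_empty; case: ifP => // _; rewrite mulr0 addr0.
rewrite /subdiv /flag_lift atE.
rewrite (@colpZD a _ (tdiff (at_empty xi)) (tdiff (at_empty eta))); first by ring.
by move=> t l; rewrite -tdiffZD; apply: eq_tdiff.
Qed.

Lemma flag_lift_set0 xi xs : flag_lift xi set0 xs = xi xs.
Proof. by rewrite /flag_lift colp_set0 subr0 /at_empty eqxx. Qed.

Lemma flag_lift_tdiff xi : (forall xs, flag xs -> altdel xi xs = 0) ->
  forall s xs, bisimp s xs -> tdiff (flag_lift xi) s xs = 0.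
Proof.
move=> xic s xs bs; rewrite tdiffB colp_tdiff ?subrr // => [t l _|l fl].
  exact: tdiffK.
by rewrite tdiff_at_empty xic.
Qed.

Lemma tdiff_nil y s : tdiff y s [::] = bd (fun t => y t [::]) s.
Proof. by rewrite /tdiff /altdel mulr0 addr0. Qed.

Lemma subdiv_cocycle xi : (forall xs, flag xs -> altdel xi xs = 0) ->
  forall s, s \in S -> bd (subdiv xi) s = 0.
Proof.
by move=> xic s sS; rewrite -tdiff_nil; apply: flag_lift_tdiff => //; apply: bisimp_nil.
Qed.

Lemma subdiv_set0 xi : subdiv xi set0 = xi [::].
Proof. exact: flag_lift_set0. Qed.

(** [flag_lift xi] and [tdiff (at_empty eta)] agree at the empty simplex, so they differ by the
    coboundary of a [colp]. On the empty flag the second one vanishes because [eta [::] = 0]. *)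
Lemma subdiv_cobound xi eta :
    xi [::] = 0 -> eta [::] = 0 -> (forall xs, flag xs -> xi xs = altdel eta xs) ->
  exists2 w, w set0 = 0 & forall s, s \in S -> subdiv xi s = bd w s.
Proof.
move=> xi0 eta0 xie.
have xic xs : flag xs -> altdel xi xs = 0.
  move=> fl; rewrite -(altdelK eta xs); apply: eq_altdel => l ls _; apply: xie.
  by apply: bisimp_flag (bisimp_subseq ls (bisimp0 fl)).
pose y s xs := flag_lift xi s xs - tdiff (at_empty eta) s xs.
have yc s xs : bisimp s xs -> tdiff y s xs = 0.
  by move=> bs; rewrite tdiffB tdiffK flag_lift_tdiff ?subr0.
have y0 xs : flag xs -> y set0 xs = 0.
  by move=> fl; rewrite /y flag_lift_set0 tdiff_at_empty xie ?subrr.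
have uy := colp_tdiff yc y0.
exists (fun t => colp y t [::]); first exact: colp_set0.
move=> s sS; rewrite -tdiff_nil uy ?bisimp_nil // /y -/(subdiv xi s) tdiff_nil.
rewrite (@eq_bd _ _ _ (fun=> 0)) ?bd0 ?subr0 // => t _ _.
by rewrite /at_empty; case: ifP.
Qed.

Lemma tdiff_at_nil w s : w set0 = 0 -> tdiff (at_nil w) s [::] = bd w s.
Proof. by rewrite tdiff_nil. Qed.

Lemma tdiff_at_nil0 w xs : w set0 = 0 -> tdiff (at_nil w) set0 xs = 0.
Proof.
move=> w0; rewrite /tdiff bd_set0 add0r.
by rewrite (@eq_altdel _ _ _ (fun=> 0)) ?altdel0 ?mulr0 // => -[].
Qed.

(** Subtracting [tdiff (at_nil w)] from [flag_lift xi] kills the values on the empty flag; the row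
    primitive of the difference, read at the empty simplex, is [eta]. *)
Lemma subdiv_inj xi w :
    xi [::] = 0 -> w set0 = 0 -> (forall xs, flag xs -> altdel xi xs = 0) ->
    (forall s, s \in S -> subdiv xi s = bd w s) ->
  exists2 eta, eta [::] = 0 & forall xs, flag xs -> xi xs = altdel eta xs.
Proof.
move=> xi0 w0 xic fw.
pose y s xs := flag_lift xi s xs - tdiff (at_nil w) s xs.
have yc s xs : bisimp s xs -> tdiff y s xs = 0.
  by move=> bs; rewrite tdiffB tdiffK flag_lift_tdiff ?subr0.
have y0 s : bisimp s [::] -> y s [::] = 0.
  case/and3P=> + _ _; rewrite /y tdiff_at_nil // -/(subdiv xi s).
  by case/orP=> [/eqP->|/fw->]; rewrite ?subrr // bd_set0 subdiv_set0 xi0 subr0.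
have [u u0 uy] := row_prim yc y0.
exists (u set0) => // xs fl; have := uy _ _ (bisimp0 fl).
by rewrite /y flag_lift_set0 tdiff_at_nil0 // subr0 /tdiff bd_set0 cards0 add0r mul1r.
Qed.

(** If [u] is the row primitive of [tdiff (at_nil w)], then [at_nil w - u] is a cocycle with value
    [w] on the empty flag, and [xi] is its restriction to the empty simplex. There it agrees with
    [flag_lift xi], so a column primitive of the difference provides [w']. *)
Lemma subdiv_surj w : w set0 = 0 -> (forall s, s \in S -> bd w s = 0) ->
  exists xi, [/\ xi [::] = 0, forall xs, flag xs -> altdel xi xs = 0 &
    exists2 w', w' set0 = 0 & forall s, s \in S -> w s - subdiv xi s = bd w' s].
Proof.
move=> w0 wc.
have [|s|u u0 uw] := @row_prim (tdiff (at_nil w)).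
- by move=> s xs _; apply: tdiffK.
- case/and3P=> + _ _; rewrite tdiff_at_nil //.
  by case/orP=> [/eqP->|/wc//]; rewrite bd_set0.
pose y s xs := at_nil w s xs - u s xs.
have yc s xs : bisimp s xs -> tdiff y s xs = 0.
  by move=> bs; rewrite tdiffB uw ?subrr.
have y0 : y set0 [::] = 0 by rewrite /y u0 subr0.
have xic xs : flag xs -> altdel (y set0) xs = 0.
  move=> fl; have := yc _ _ (bisimp0 fl).
  by rewrite /tdiff bd_set0 cards0 add0r mul1r.
exists (y set0); split=> //.
pose z s xs := y s xs - flag_lift (y set0) s xs.
have zc s xs : bisimp s xs -> tdiff z s xs = 0.
  by move=> bs; rewrite tdiffB yc // flag_lift_tdiff // subr0.
have z0 xs : flag xs -> z set0 xs = 0 by move=> _; rewrite /z flag_lift_set0 subrr.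
exists (fun t => colp z t [::]); first exact: colp_set0.
move=> s sS; rewrite -tdiff_nil (colp_tdiff zc z0) ?bisimp_nil //.
by rewrite /z /subdiv /y /= u0 subr0.
Qed.

(** Flag cochains carry no degree; this is what allows the passage to the homogeneous cochains of
    the theorem. *)
Lemma subdiv_degree m xi :
    (forall xs, flag xs -> size xs = m -> xi xs = 0) ->
  forall s, s \in S -> #|s| = m -> subdiv xi s = 0.
Proof.
move=> xi0 s sS sm; rewrite /subdiv /flag_lift /at_empty (negPf (simp_neq0 sS)) sub0r.
rewrite (@colp_degree m) ?oppr0 ?addn0 ?bisimp_nil //= => t l bt e.
rewrite (@eq_tdiff _ (fun _ _ => 0)) ?tdiff0 // => t' l' tt ll /eqP; rewrite e eqSS => /eqP e'.
case: ifP => // /eqP t0; apply: xi0; last by rewrite -e' t0 cards0.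
by apply: bisimp_flag (bisimp_subseq ll bt).
Qed.

End Subdivision.

(** * The bar differential *)

Section Bar.
Variables (k : fieldType) (T : Type) (op : T -> T -> option T).
Implicit Types (g : seq T -> k) (la : T -> seq T -> k).

(* The faces of positive index of a bar-type differential: [la z m] is the last
   face of [rcons m z]; the face of index 0 is treated separately. *)
Fixpoint bar g la (l : seq T) : k :=
  if l is a :: l' then
    - (if l' is a' :: l'' then
         (if op a a' is Some c then g (c :: l'') else 0)
         + bar (fun m => g (a :: m)) (fun z m => la z (a :: m)) l'
       else la a [::])
  else 0.

Lemma bar1 g la a : bar g la [:: a] = - la a [::].
Proof. by []. Qed.

Lemma bar_cons2 g la a b l : bar g la [:: a, b & l] =
  - ((if op a b is Some c then g (c :: l) else 0)
     + bar (fun m => g (a :: m)) (fun z m => la z (a :: m)) (b :: l)).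
Proof. by []. Qed.

#[local] Arguments bar : simpl never.

(** Link with the indexed sums: [hoch] and [dsimp] are both a face of index 0 plus a [bar], with
    [mulB] or the composition of arrows as [op]. *)
Lemma bar_sum g la x0 a l :
  \sum_(1 <= i < size (a :: l)) (-1) ^+ i *
     (if op (nth x0 (a :: l) i.-1) (nth x0 (a :: l) i) is Some c
      then g (take i.-1 (a :: l) ++ c :: drop i.+1 (a :: l)) else 0)
  + (-1) ^+ size (a :: l) * la (last a l) (belast a l) = bar g la (a :: l).
Proof.
elim: l a g la => [|b l IH] a g la.
  by rewrite big_geq //= add0r expr1 mulN1r bar1.
rewrite bar_cons2 -IH [size _]/= big_ltn // big_add1 /= drop0 expr1 [(-1) ^+ _.+2]exprS.
set A := match _ with Some _ => _ | None => _ end; set B := \sum_(_ <= _ < _) _.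
set D := \sum_(_ <= _ < _) _; set E := la _ _.
suff -> : B = - D by ring.
rewrite /B /D -sumrN; apply: eq_big_nat => -[//|i] /= _.
by rewrite exprS mulN1r mulNr.
Qed.

Lemma eq_bar g la g' la' l :
    (forall p x y c q, l = p ++ x :: y :: q -> op x y = Some c ->
       g (p ++ c :: q) = g' (p ++ c :: q)) ->
    (forall p z, l = rcons p z -> la z p = la' z p) ->
  bar g la l = bar g' la' l.
Proof.
elim: l g la g' la' => [//|a [|a' l] IH] g la g' la' eg ela.
  by rewrite !bar1 (ela [::]).
rewrite !bar_cons2; congr (- (_ + _)).
  by case e: (op a a') => [c|] //; apply: (eg [::] a a' c l).
apply: (IH (fun m => g (a :: m)) _ (fun m => g' (a :: m))).
  by move=> p x y c q e oe; apply: (eg (a :: p) x y c q); rewrite // e.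
by move=> p z e; apply: (ela (a :: p)); rewrite e.
Qed.

Lemma barZD a g la g' la' l :
  bar (fun m => a * g m + g' m) (fun z m => a * la z m + la' z m) l =
  a * bar g la l + bar g' la' l.
Proof.
elim: l g la g' la' => [|b [|b' l] IH] g la g' la'; first by rewrite /bar mulr0 addr0.
  by rewrite !bar1; ring.
rewrite !bar_cons2 (IH (fun m => g (b :: m)) (fun z m => la z (b :: m))
  (fun m => g' (b :: m)) (fun z m => la' z (b :: m))).
by case: (op b b') => [c|] /=; ring.
Qed.

Lemma bar0 l : bar (fun=> 0) (fun _ _ => 0) l = 0.
Proof.
elim: l => [//|a [|b l] IH]; first by rewrite bar1 oppr0.
by rewrite bar_cons2 IH; case: (op a b) => [_|]; rewrite addr0 oppr0.
Qed.

Lemma barZ a g la l :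
  bar (fun m => a * g m) (fun z m => a * la z m) l = a * bar g la l.
Proof.
rewrite -[RHS]addr0 -[X in _ + X](bar0 l) -barZD.
by apply: eq_bar => *; rewrite addr0.
Qed.

End Bar.

#[local] Arguments bar : simpl never.

(** * Basis tensors as walks in the face poset, and their first gap *)

Section Gaps.
Variables (k : fieldType) (V : finType).
Implicit Types (x y : {set V}) (l : seq (Bas V)).

Fixpoint composable x l y : bool :=
  if l is a :: l' then (x == a.1) && composable a.2 l' y else x == y.

(** The inserted pair is the idempotent of the simplex where the walk breaks. A walk without inner
    break gets it at the end, which is the gap before a missed end point. *)
Fixpoint fill x l : seq (Bas V) :=
  if l is a :: l' then if x == a.1 then a :: fill a.2 l' else (x, x) :: l
  else [:: (x, x)].

Fixpoint gap x l : nat :=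
  if l is a :: l' then if x == a.1 then (gap a.2 l').+1 else 0 else 0.

Definition fill_op x y (g : seq (Bas V) -> k) l : k :=
  if composable x l y then 0 else (-1) ^+ gap x l * g (fill x l).

Lemma fill_op_cons x y g a l : x = a.1 ->
  fill_op x y g (a :: l) = -1 * fill_op a.2 y (fun m => g (a :: m)) l.
Proof. by move=> ->; rewrite /fill_op /= eqxx exprS /=; case: ifP => _; ring. Qed.

(* Filling the first gap of a non-composable tensor with an idempotent contracts
   the non-composable part of the bar complex; the face dropping the first
   factor is treated separately and only contributes when the gap comes first. *)
Lemma bar_fill x y g la l :
    (forall z m, z.2 != y -> la z m = 0) -> ~~ composable x l y ->
  bar (@mulB V) (fill_op x y g) (fun z => fill_op x z.1 (la z)) l
    + (-1) ^+ gap x l * bar (@mulB V) g la (fill x l)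
  = if gap x l == 0%N then 0 else g l.
Proof.
elim: l x g la => [|a l IH] x g la la0.
  by move=> /= xy; rewrite bar1 la0 // /bar; ring.
(* When the gap comes first, the idempotent times the next factor is zero, and all faces considered
   keep the gap in front, so the two sums cancel. *)
case: (eqVneq x a.1) => [xa|nxa] nc; last first.
  rewrite /= (negPf nxa) /= bar_cons2 {2}/mulB /= (negPf nxa) add0r mul1r.
  apply/eqP; rewrite subr_eq0; apply/eqP.
  apply: eq_bar => [p b c d q|p z]; rewrite /fill_op.
    case: p => [|p0 p] [<-]; last by move=> _ _ /=; rewrite (negPf nxa) mul1r.
    by rewrite /mulB; case: ifP => // _ _ [<-] /=; rewrite (negPf nxa) mul1r.
  by case: p => [|p0 p] [<-] /=; rewrite (negPf nxa) mul1r.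
have nc' : ~~ composable a.2 l y by move: nc; rewrite /= xa eqxx.
have IH' := IH _ (fun m => g (a :: m)) (fun z m => la z (a :: m)) (fun z m => la0 z _) nc'.
have -> : bar (@mulB V) (fill_op x y g) (fun z => fill_op x z.1 (la z)) (a :: l) =
    (if l is a' :: l' then if mulB a a' is Some c then - fill_op x y g (c :: l') else 0 else 0)
    + bar (@mulB V) (fill_op a.2 y (fun m => g (a :: m)))
        (fun z => fill_op a.2 z.1 (fun m => la z (a :: m))) l.
  case: (l) => [|a' l']; first by rewrite bar1 /fill_op /= xa eqxx /bar oppr0 addr0.
  rewrite bar_cons2 opprD; congr (_ + _); first by case: (mulB a a') => [c|]; rewrite ?oppr0.
  rewrite -mulN1r -barZ; apply: eq_bar => *; rewrite fill_op_cons //; ring.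
rewrite [gap x _]/= [fill x _]/= xa eqxx /=.
case: l nc' IH' {IH nc} => [|a' l] nc' IH'.
  rewrite /= bar_cons2 bar1 {2}/mulB /= eqxx la0 // /bar -surjective_pairing; ring.
have mE : mulB a a' = if a.2 == a'.1 then Some (a.1, a'.2) else None by [].
move: IH' nc'; rewrite mE [gap _ _]/= [fill _ _]/= [composable _ _ _]/=.
case: eqVneq => [aa|naa] /= IH' nc'.
  rewrite bar_cons2 mE aa eqxx -IH' [fill_op a.1 y g _]/fill_op /= eqxx (negPf nc') /= aa !exprS; ring.
(* Here [a] is the last factor before the gap, and its product with the idempotent restores the
   original tensor. *)
rewrite bar_cons2 {2}/mulB /= eqxx -surjective_pairing expr1.
by move/eqP: IH'; rewrite expr0 mul1r addr_eq0 => /eqP ->; ring.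
Qed.

End Gaps.

(** * Push-forward along strings of arrows *)

Section Pushforward.
Variables (k : fieldType) (C : fincat) (V : finType).
Variables (Sg : Ob C -> {set {set V}}) (Sm : Mor C -> V -> V).
Hypotheses (HC : is_category C) (HF : is_functor_SimpComp Sg Sm).
Implicit Types (c : Ob C) (f g : Mor C) (fs : seq (Mor C)) (s t x y : {set V}).
Implicit Types (a b e : Bas V) (l : seq (Bas V)) (xs : seq {set V}) (G : cofun k C V).

Lemma simpcomp c : is_simpcomp (Sg c). Proof. by case: HF. Qed.

Lemma Sm_in f s : s \in Sg (src f) -> Sm f @: s \in Sg (tgt f).
Proof. by case: HF => _ /(_ f)[h _] _ _ /h. Qed.

Lemma in_verts (S : {set {set V}}) s v : s \in S -> v \in s -> v \in verts S.
Proof. by move=> sS vs; apply/bigcupP; exists s. Qed.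

Lemma Sm_sub f s t : s \in Sg (src f) -> t \in Sg (src f) ->
  (Sm f @: s \subset Sm f @: t) = (s \subset t).
Proof.
case: HF => _ /(_ f)[_ inj] _ _ sS tS; apply/idP/idP; last exact: imsetS.
move=> /subsetP h; apply/subsetP=> v vs; have /imsetP[w wt] := h _ (imset_f (Sm f) vs).
by move/inj => -> //; [apply: in_verts vs | apply: in_verts wt].
Qed.

Lemma Sm_lower f s y : s \in Sg (src f) -> y \subset Sm f @: s -> y != set0 ->
  exists2 t, t \in Sg (src f) & y = Sm f @: t.
Proof.
move=> sS ys y0; pose t := [set v in s | Sm f v \in y].
have yt : y = Sm f @: t.
  apply/setP=> w; apply/idP/imsetP => [wy|[v]]; last by rewrite inE => /andP[_ ?] ->.
  have /imsetP[v vs wv] := subsetP ys w wy; exists v => //.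
  by rewrite inE vs -wv.
exists t => //; apply: (simp_sub (simpcomp _) sS); first by apply/subsetP=> v; rewrite inE => /andP[].
by apply: contraNneq y0 => t0; rewrite yt t0 imset0.
Qed.

Lemma Sm_comp f g s : tgt f = src g -> s \in Sg (src f) ->
  Sm (Defs.comp g f) @: s = Sm g @: (Sm f @: s).
Proof.
case: HF => _ _ _ h fg sS; rewrite -imset_comp; apply: eq_in_imset => v vs.
by apply: h => //; apply: in_verts vs.
Qed.

Lemma Sm_id c s : s \in Sg c -> Sm (idm c) @: s = s.
Proof.
case: HF => _ _ h _ sS; rewrite -[RHS]imset_id; apply: eq_in_imset => v vs.
by apply: h; apply: in_verts vs.
Qed.

Definition push fs s := foldl (fun t f => Sm f @: t) s fs.
Definition pushB fs b : Bas V := (push fs b.1, push fs b.2).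

Lemma chain_cat c fs1 fs2 :
  chain c (fs1 ++ fs2) = chain c fs1 && chain (endp c fs1) fs2.
Proof. by elim: fs1 c => [//|f fs1 IH] c /=; rewrite IH andbA. Qed.

Lemma endp_cat c fs1 fs2 : endp c (fs1 ++ fs2) = endp (endp c fs1) fs2.
Proof. by elim: fs1 c => [//|f fs1 IH] c /=. Qed.

Lemma push_cat fs1 fs2 s : push (fs1 ++ fs2) s = push fs2 (push fs1 s).
Proof. exact: foldl_cat. Qed.

Lemma chain_rcons c fs f : chain c (rcons fs f) = chain c fs && (src f == endp c fs).
Proof. by rewrite -cats1 chain_cat /= andbT. Qed.

Lemma endp_rcons c fs f : endp c (rcons fs f) = tgt f.
Proof. by rewrite -cats1 endp_cat. Qed.

Lemma push_rcons fs f s : push (rcons fs f) s = Sm f @: push fs s.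
Proof. by rewrite -cats1 push_cat. Qed.

Lemma push_in c fs s : chain c fs -> s \in Sg c -> push fs s \in Sg (endp c fs).
Proof.
elim: fs c s => [//|f fs IH] c s /= /andP[/eqP<- ch] sS.
by apply: IH => //; apply: Sm_in.
Qed.

Lemma push_sub c fs s t : chain c fs -> s \in Sg c -> t \in Sg c ->
  (push fs s \subset push fs t) = (s \subset t).
Proof.
elim: fs c s t => [//|f fs IH] c s t /= /andP[/eqP<- ch] sS tS.
by rewrite (IH (tgt f)) ?Sm_in // Sm_sub.
Qed.

Lemma push_eq c fs s t : chain c fs -> s \in Sg c -> t \in Sg c ->
  (push fs s == push fs t) = (s == t).
Proof. by move=> ch sS tS; rewrite !eqEsubset !(push_sub ch). Qed.

Lemma push_lower c fs s y : chain c fs -> s \in Sg c -> y \subset push fs s ->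
  y != set0 -> exists2 t, t \in Sg c & y = push fs t.
Proof.
elim: fs c s y => [|f fs IH] c s y /=.
  by move=> _ sS ys y0; exists y => //; exact: (simp_sub (simpcomp c) sS).
move=> /andP[/eqP<- ch] sS ys y0.
have [t tS ey] := IH _ _ _ ch (Sm_in sS) ys y0.
have ts : t \subset Sm f @: s by rewrite -(push_sub ch) ?Sm_in // -ey.
have [r rS er] := Sm_lower sS ts (simp_neq0 (simpcomp _) tS).
by exists r; rewrite // -er.
Qed.

Lemma pushB_bas c fs a : chain c fs -> isbas (Sg c) a -> isbas (Sg (endp c fs)) (pushB fs a).
Proof.
move=> ch /and3P[a1 a2 a12]; apply/and3P; split; rewrite /= ?push_in //.
by rewrite (push_sub ch).
Qed.

Lemma pushB_eq c fs a b : chain c fs -> isbas (Sg c) a -> isbas (Sg c) b ->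
  (pushB fs a == pushB fs b) = (a == b).
Proof.
move=> ch /and3P[a1 a2 _] /and3P[b1 b2 _].
by rewrite -!pair_eqE /pair_eq /= !(push_eq ch).
Qed.

Lemma resB_some f b a : resB Sg Sm f b = Some a ->
  isbas (Sg (src f)) a /\ pushB [:: f] a = b.
Proof. by rewrite /resB; case: pickP => // e /andP[be /eqP eb] [<-]. Qed.

Lemma resB_push f a : isbas (Sg (src f)) a -> resB Sg Sm f (pushB [:: f] a) = Some a.
Proof.
move=> ba; rewrite /resB; case: pickP => [e|/(_ a)]; last by rewrite ba eqxx.
case/andP=> be; rewrite -/(pushB [:: f] e) (@pushB_eq (src f)) //= ?eqxx //.
by move/eqP->.
Qed.

Lemma resB_eqSome f b a : isbas (Sg (src f)) a ->
  (resB Sg Sm f b == Some a) = (b == pushB [:: f] a).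
Proof.
move=> ba; apply/eqP/eqP => [/resB_some[_ ->] //|->]; exact: resB_push.
Qed.

Lemma resS_cons f fs b : resS Sg Sm (f :: fs) b = obind (resB Sg Sm f) (resS Sg Sm fs b).
Proof. by []. Qed.

Lemma resS_some fs b e : resS Sg Sm fs b = Some e -> pushB fs e = b.
Proof.
elim: fs e => [|f fs IH] e; first by case=> <-; case: b.
by rewrite resS_cons; case er: (resS _ _ fs b) => [d|] //= /resB_some[_ ed]; rewrite -(IH d er) -ed.
Qed.

Lemma resS_bas c fs b e : chain c fs -> isbas (Sg (endp c fs)) b ->
  resS Sg Sm fs b = Some e -> isbas (Sg c) e.
Proof.
case: fs => [|f fs]; first by move=> _ bb [<-].
rewrite resS_cons => /andP[/eqP<- _] _; by case: (resS _ _ fs b) => [d|] //= /resB_some[].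
Qed.

Lemma resS_push c fs e : chain c fs -> isbas (Sg c) e ->
  resS Sg Sm fs (pushB fs e) = Some e.
Proof.
elim: fs c e => [|f fs IH] c e; first by case: e.
move=> /andP[/eqP<- ch] be.
have be' : isbas (Sg (tgt f)) (pushB [:: f] e).
  by apply: (@pushB_bas (src f)) => //=; rewrite eqxx.
have -> : pushB (f :: fs) e = pushB fs (pushB [:: f] e) by [].
by rewrite resS_cons (IH (tgt f)) //= resB_push.
Qed.

Lemma push_comp c p f g q s : chain c (p ++ f :: g :: q) -> s \in Sg c ->
  push (p ++ Defs.comp g f :: q) s = push (p ++ f :: g :: q) s.
Proof.
rewrite chain_cat => /andP[chp /= /and3P[/eqP sf /eqP sg _]] sS.
by rewrite !push_cat /= Sm_comp // sf push_in.
Qed.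

Lemma chain_comp c p f g q : chain c (p ++ f :: g :: q) ->
  chain c (p ++ Defs.comp g f :: q) /\
  endp c (p ++ Defs.comp g f :: q) = endp c (p ++ f :: g :: q).
Proof.
rewrite !chain_cat !endp_cat => /andP[-> /= /and3P[/eqP sf /eqP sg chq]].
by case: HC => _ /(_ f g (esym sg)) [-> ->] _ _; rewrite sf eqxx chq.
Qed.

(** In an incidence algebra at most one basis element [b'] has product [b] with a given [e], so the
    sum over [b'] in [hoch] has at most one term. *)
Definition lact fs a (h : Bas V -> k) b : k :=
  if resS Sg Sm fs a is Some e then
    if (e.1 == b.1) && (e.2 \subset b.2) then h (e.2, b.2) else 0 else 0.

Definition ract fs a (h : Bas V -> k) b : k :=
  if resS Sg Sm fs a is Some e then
    if (e.2 == b.2) && (b.1 \subset e.1) then h (b.1, e.1) else 0 else 0.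

Definition valid c fs l b := validD Sg (c, fs, l, b).

Lemma lact_sum c e (h : Bas V -> k) b : isbas (Sg c) e -> isbas (Sg c) b ->
  \sum_(b' : Bas V | isbas (Sg c) b' && (mulB e b' == Some b)) h b' =
  if (e.1 == b.1) && (e.2 \subset b.2) then h (e.2, b.2) else 0.
Proof.
move=> /and3P[e1 e2 e12] /and3P[b1 b2 b12]; case: ifP => [/andP[/eqP eb sb]|/negP n].
  rewrite (big_pred1 (e.2, b.2)) // => -[d1 d2] /=; rewrite /isbas /mulB /=.
  apply/idP/eqP => [|[-> ->]]; last by rewrite e2 b2 sb eqxx eb -surjective_pairing eqxx.
  by case/andP=> _; case: (e.2 =P d1) => // <- /eqP[<-].
rewrite big1 // => -[d1 d2] /andP[/and3P[_ /= d2S d12]]; rewrite /mulB /=.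
by case: (e.2 =P d1) => // ed /eqP[eb]; case: n; rewrite -eb /= eqxx ed.
Qed.

Lemma ract_sum c e (h : Bas V -> k) b : isbas (Sg c) e -> isbas (Sg c) b ->
  \sum_(b' : Bas V | isbas (Sg c) b' && (mulB b' e == Some b)) h b' =
  if (e.2 == b.2) && (b.1 \subset e.1) then h (b.1, e.1) else 0.
Proof.
move=> /and3P[e1 e2 e12] /and3P[b1 b2 b12]; case: ifP => [/andP[/eqP eb sb]|/negP n].
  rewrite (big_pred1 (b.1, e.1)) // => -[d1 d2] /=; rewrite /isbas /mulB /=.
  apply/idP/eqP => [|[-> ->]]; last by rewrite e1 b1 sb eqxx eb -surjective_pairing eqxx.
  by case/andP=> _; case: (d2 =P e.1) => // -> /eqP[<-].
rewrite big1 // => -[d1 d2] /andP[/and3P[_ /= d2S d12]]; rewrite /mulB /=.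
by case: (d2 =P e.1) => // ed /eqP[eb]; case: n; rewrite -eb /= eqxx -ed.
Qed.

Lemma hoch_bar G c fs a l b : valid c fs (a :: l) b ->
  hoch Sg Sm G c fs (a :: l) b = lact fs a (G c fs l) b
    + bar (@mulB V) (fun m => G c fs m b) (fun z m => ract fs z (G c fs m) b) (a :: l).
Proof.
rewrite /valid /validD => /and3P[ch al bb]; rewrite -(bar_sum _ _ _ a) /hoch -addrA.
have aP z : z \in a :: l -> isbas (Sg (endp c fs)) z by apply/allP.
congr (_ + (_ + _ * _)).
  rewrite /lact; case er: (resS _ _ _ _) => [e|] //.
  apply: lact_sum => //; apply: (resS_bas ch _ er); exact: aP (mem_head _ _).
rewrite /ract; case er: (resS _ _ _ _) => [e|] //.
by apply: ract_sum => //; apply: (resS_bas ch _ er); apply: aP (mem_last _ _).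
Qed.

Definition compop f g := Some (Defs.comp g f).

Definition resL f l (h : seq (Bas V) -> k) : k :=
  let ras := map (resB Sg Sm f) l in
  if all (fun o => o != None) ras then h (pmap id ras) else 0.

Lemma resL_push f l h : all (isbas (Sg (src f))) l ->
  resL f (map (pushB [:: f]) l) h = h l.
Proof.
move=> al; rewrite /resL; have -> : map (resB Sg Sm f) (map (pushB [:: f]) l) = map Some l.
  by rewrite -map_comp; apply/eq_in_map => a /(allP al) ba; apply: resB_push.
have [-> e] : all (fun o => o != None) (map Some l) /\ pmap id (map Some l) = l.
  by elim: l {al} => //= a l [-> ->].
by congr h.
Qed.

Lemma resL_cases f l :
  (exists2 m, all (isbas (Sg (src f))) m & l = map (pushB [:: f]) m) \/
  (exists2 a, a \in l & resB Sg Sm f a = None).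
Proof.
elim: l => [|a l [[m bm ->]|[d dl dn]]]; first by left; exists [::].
  case ra: (resB Sg Sm f a) => [d|]; last by right; exists a; rewrite ?mem_head.
  have [bd <-] := resB_some ra; left; exists (d :: m) => //=.
  by rewrite bd.
by right; exists d; rewrite // inE dl orbT.
Qed.

Lemma resL_none f l h a : a \in l -> resB Sg Sm f a = None -> resL f l h = 0.
Proof.
move=> al an; rewrite /resL; case: ifP => // /allP/(_ None).
by rewrite -an map_f // an eqxx => /(_ isT).
Qed.

(** Restricting the value of a cochain amounts, on coefficients, to evaluating at the push-forward
    of [b]: by injectivity the sum in [dsimp] has this single term. *)
Lemma dsimp_bar G c f fs l b : valid c (f :: fs) l b ->
  dsimp Sg Sm G c (f :: fs) l b = G (tgt f) fs l (pushB [:: f] b)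
    + bar compop (fun m => G c m l b) (fun z m => resL z l (fun l' => G c m l' b)) (f :: fs).
Proof.
rewrite /valid /validD => /and3P[/= /andP[/eqP cf ch] al bb].
rewrite -(bar_sum _ _ _ f) /dsimp -addrA; congr (_ + _).
rewrite (big_pred1 (pushB [:: f] b)) // => d /=.
rewrite resB_eqSome ?cf //; case: eqVneq => [->|_]; rewrite ?andbF ?andbT //.
by apply: (@pushB_bas c); rewrite //= cf eqxx.
Qed.

End Pushforward.

(** * Non-composable tensors *)

#[local] Arguments hoch : simpl never.
#[local] Arguments dsimp : simpl never.

Section Noncomposable.
Variables (k : fieldType) (C : fincat) (V : finType).
Variables (Sg : Ob C -> {set {set V}}) (Sm : Mor C -> V -> V).
Hypotheses (HC : is_category C) (HF : is_functor_SimpComp Sg Sm).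
Implicit Types (c : Ob C) (f g : Mor C) (fs : seq (Mor C)) (s t x y : {set V}).
Implicit Types (a b e : Bas V) (l m : seq (Bas V)) (G : cofun k C V).

Notation push := (push Sm).
Notation pushB := (pushB Sm).
Notation valid := (valid Sg).
Notation lact := (lact Sg Sm).
Notation ract := (ract Sg Sm).
Notation resL := (resL Sg Sm).

(** The tensor is a walk between the images of the two ends of [b], so together with [b] it closes
    up. *)
Definition closed_up fs l b := composable (push fs b.1) l (push fs b.2).

Lemma composable_cat x y l1 l2 :
  composable x (l1 ++ l2) y =
  composable x l1 (last x (map snd l1)) && composable (last x (map snd l1)) l2 y.
Proof. by elim: l1 x => [|a l1 IH] x /=; rewrite ?eqxx // IH andbA. Qed.

Lemma composable_merge x y p a b q d : mulB a b = Some d ->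
  composable x (p ++ d :: q) y = composable x (p ++ a :: b :: q) y.
Proof.
rewrite /mulB; case: ifP => // /eqP ab [<-].
by rewrite !composable_cat /= ab eqxx.
Qed.

Lemma composable_rcons x y p a :
  composable x (rcons p a) y = composable x p a.1 && (a.2 == y).
Proof. by elim: p x => [|d p IH] x //=; rewrite IH andbA. Qed.

Lemma validP c fs l b : reflect
  [/\ chain c fs, all (isbas (Sg (endp c fs))) l & isbas (Sg c) b] (valid c fs l b).
Proof. exact: and3P. Qed.

(** Half of the splitting of the complex: products do not change composability, and an outer factor
    acts non-trivially only if it matches the corresponding end of [b]. *)
Lemma eq_hoch G G' c fs l b : valid c fs l b ->
    (forall m d, valid c fs m d -> closed_up fs m d = closed_up fs l b ->
      (size m).+1 = size l -> G c fs m d = G' c fs m d) ->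
  hoch Sg Sm G c fs l b = hoch Sg Sm G' c fs l b.
Proof.
case: l => [//|a l] vl e; rewrite !(hoch_bar Sm _ vl).
have /validP[ch /= /andP[ba al] bb] := vl.
have /and3P[b1 b2 b12] := bb.
congr (_ + _).
  rewrite /lact; case er: (resS _ _ _ _) => [d|] //; case: ifP => // /andP[/eqP d1 d2].
  have /and3P[d1S d2S d12] := resS_bas ch ba er.
  apply: e => //; first by apply/validP; split=> //; apply/and3P.
  by rewrite /closed_up /= -(resS_some er) /= d1 eqxx.
have cat_all p q : all (isbas (Sg (endp c fs))) (p ++ q) =
   all (isbas (Sg (endp c fs))) p && all (isbas (Sg (endp c fs))) q by rewrite all_cat.
apply: eq_bar => [p x y d q el od|p z el].
  apply: e.
  - apply/validP; split=> //; have : all (isbas (Sg (endp c fs))) (a :: l) by apply/andP.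
    rewrite el !all_cat /= => /and4P[-> bx yy ->]; rewrite andbT /=.
    move: od; rewrite /mulB; case: ifP => // /eqP xy [<-].
    case/and3P: bx yy => x1 x2 x12 /and3P[y1 y2 y12]; apply/and3P; split=> //.
    by apply: subset_trans y12; rewrite -xy.
  - by rewrite /closed_up el (composable_merge _ _ _ _ od).
  - by rewrite el !size_cat /= !addnS.
rewrite /ract; case er: (resS _ _ _ _) => [d|] //; case: ifP => // /andP[/eqP d2 d1].
have : all (isbas (Sg (endp c fs))) (rcons p z) by rewrite -el /= ba.
rewrite all_rcons => /andP[bz ap].
have /and3P[d1S d2S d12] := resS_bas ch bz er.
apply: e => //; first by apply/validP; split=> //; apply/and3P.
  by rewrite /closed_up el composable_rcons -(resS_some er) /= d2 eqxx andbT.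
by rewrite el size_rcons.
Qed.

Lemma hochZD r G G' c fs l b : valid c fs l b ->
  hoch Sg Sm (fun c fs l b => r * G c fs l b + G' c fs l b) c fs l b =
  r * hoch Sg Sm G c fs l b + hoch Sg Sm G' c fs l b.
Proof.
case: l => [|a l] vl; first by rewrite /hoch mulr0 addr0.
rewrite !(hoch_bar Sm _ vl) mulrDr addrACA -barZD; congr (_ + _).
  by rewrite /lact; case: resS => [e|]; first case: ifP => _; rewrite ?mulr0 ?addr0.
apply: eq_bar => // p z _.
by rewrite /ract; case: resS => [e|]; first case: ifP => _; rewrite ?mulr0 ?addr0.
Qed.

Lemma map_pushB_inj f s y m : s \in Sg (src f) -> y \in Sg (src f) ->
  all (isbas (Sg (src f))) m ->
  [/\ fill (Sm f @: s) (map (pushB [:: f]) m) = map (pushB [:: f]) (fill s m),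
      gap (Sm f @: s) (map (pushB [:: f]) m) = gap s m
    & composable (Sm f @: s) (map (pushB [:: f]) m) (Sm f @: y) = composable s m y].
Proof.
have eqS u v : u \in Sg (src f) -> v \in Sg (src f) -> (Sm f @: u == Sm f @: v) = (u == v).
  by move=> uS vS; rewrite !eqEsubset !(Sm_sub HF).
elim: m s => [|a m IH] s sS yS /=; first by rewrite eqS.
case/andP=> /and3P[a1 a2 _] am; rewrite eqS //; have [e1 e2 e3] := IH _ a2 yS am.
by rewrite e1 e2 e3; case: ifP.
Qed.

Lemma all_isbas_fill (S : {set {set V}}) s m : s \in S -> all (isbas S) m ->
  all (isbas S) (fill s m).
Proof.
elim: m s => [|a m IH] s sS; first by rewrite /= /isbas /= sS subxx.
case/andP=> ba am /=; case: ifP => _ /=; rewrite ?ba ?IH // ?am.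
  by case/and3P: ba.
by rewrite /isbas /= sS subxx.
Qed.

Lemma mem_fill s m a : a \in m -> a \in fill s m.
Proof.
elim: m s => [//|d m IH] s; rewrite inE /= => /orP[/eqP->|am]; case: ifP => _.
- exact: mem_head.
- by rewrite !inE eqxx orbT.
- by rewrite inE IH // orbT.
- by rewrite !inE am !orbT.
Qed.

(** The other half of the splitting: walks are moved along injective maps, which preserve and
    reflect equality of simplices. *)
Lemma eq_dsimp G G' c fs l b : valid c fs l b ->
    (forall c' gs m d, valid c' gs m d -> closed_up gs m d = closed_up fs l b ->
      (size gs).+1 = size fs -> size m = size l -> G c' gs m d = G' c' gs m d) ->
  dsimp Sg Sm G c fs l b = dsimp Sg Sm G' c fs l b.
Proof.
case: fs => [//|f fs] vl e; rewrite !(dsimp_bar HF _ vl).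
have /validP[/= /andP[/eqP sf ch] al bb] := vl.
have ch' : chain c (f :: fs) by rewrite /= sf eqxx.
have /and3P[b1 b2 b12] := bb.
congr (_ + _).
  apply: e => //; apply/validP; split=> //.
  by apply: (pushB_bas HF (c := c)); rewrite //= sf eqxx.
apply: eq_bar => [p x y d q el [<-]|p z el].
  have [] := chain_comp HC (p := p) (f := x) (g := y) (q := q) (c := c); first by rewrite -el.
  move=> ch2 en; apply: e => //.
  - by apply/validP; split; rewrite // en -el.
  - by rewrite /closed_up !(push_comp HF (c := c)) -?el.
  - by rewrite el !size_cat /= !addnS.
case: (resL_cases Sg Sm z l) => [[m am lm]|[a la an]]; last by rewrite !(resL_none _ la an).
have al' : all (isbas (Sg (endp c (f :: fs)))) l by [].
move: ch' al'; rewrite el chain_rcons endp_rcons => /andP[chp /eqP sz] {}al.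
rewrite lm !(resL_push HF) //.
apply: e; last by rewrite lm size_map.
- by apply/validP; split; rewrite // -sz.
- rewrite /closed_up el lm !push_rcons.
  have /(_ (push p b.1)) := map_pushB_inj _ (y := push p b.2) _ am.
  by rewrite sz !(push_in HF) // => /(_ isT isT)[].
- by rewrite el size_rcons.
Qed.

Lemma dsimpZD r G G' c fs l b : valid c fs l b ->
  dsimp Sg Sm (fun c fs l b => r * G c fs l b + G' c fs l b) c fs l b =
  r * dsimp Sg Sm G c fs l b + dsimp Sg Sm G' c fs l b.
Proof.
case: fs => [|f fs] vl; first by rewrite /dsimp mulr0 addr0.
rewrite !(dsimp_bar HF _ vl) mulrDr addrACA -barZD; congr (_ + _).
apply: eq_bar => // p z _.
by rewrite /resL; case: ifP => _; rewrite ?mulr0 ?addr0.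
Qed.

Definition fillG G : cofun k C V := fun c fs l b =>
  fill_op (push fs b.1) (push fs b.2) (fun m => G c fs m b) l.

Lemma valid_fill c fs l b : valid c fs l b -> valid c fs (fill (push fs b.1) l) b.
Proof.
move=> /validP[ch al bb]; apply/validP; split=> //; apply: all_isbas_fill => //.
by apply: (push_in HF) => //; case/and3P: bb.
Qed.

(** Adds the face of index 0 to [bar_fill]. If the gap comes first, that face drops the idempotent
    and gives back the tensor; otherwise its two occurrences cancel. *)
Lemma hoch_fill G c fs l b : valid c fs l b -> ~~ closed_up fs l b ->
  hoch Sg Sm (fillG G) c fs l b
    + (-1) ^+ gap (push fs b.1) l * hoch Sg Sm G c fs (fill (push fs b.1) l) b
  = G c fs l b.
Proof.
move=> vl nc; have vf := valid_fill vl.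
have /validP[ch al bb] := vl; have /and3P[b1 b2 b12] := bb.
set x := push fs b.1 in vf *.
have la0 z m : z.2 != push fs b.2 -> ract fs z (G c fs m) b = 0.
  rewrite /ract; case er: (resS _ _ _ _) => [d|] //; case: ifP => // /andP[/eqP d2 _].
  by rewrite -(resS_some er) /= d2 eqxx.
have H := @bar_fill k V x (push fs b.2) (fun m => G c fs m b)
  (fun z m => ract fs z (G c fs m) b) l la0 nc.
have E l' : bar (@mulB V) (fun m => fillG G c fs m b) (fun z m => ract fs z (fillG G c fs m) b) l'
   = bar (@mulB V) (fill_op x (push fs b.2) (fun m => G c fs m b))
      (fun z => fill_op x z.1 (fun m => ract fs z (G c fs m) b)) l'.
  apply: eq_bar => // p z _; rewrite /ract.
  case er: (resS _ _ _ _) => [d|]; last by rewrite /fill_op mulr0 if_same.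
  case: ifP => _; last by rewrite /fill_op mulr0 if_same.
  by rewrite /fillG /fill_op -(resS_some er).
case: l => [|a l] in vl nc al vf H *.
  rewrite {1}/hoch /= in vf H *; rewrite expr0 add0r mul1r (hoch_bar Sm _ vf).
  move: H; rewrite {1}/bar add0r expr0 mul1r => ->; rewrite addr0 /lact.
  have := resS_push HF (e := (b.1, b.1)) ch; rewrite /pushB /= => -> //.
    by rewrite eqxx b12 -surjective_pairing.
  by rewrite /isbas /= b1 subxx.
rewrite (hoch_bar Sm _ vl) E; move: H vf; rewrite /=.
case: eqVneq => [xa|nxa] /= H vf; rewrite (hoch_bar Sm _ vf).
  rewrite mulrDr addrACA H -[RHS]add0r; congr (_ + _).
  rewrite /lact; case er: (resS _ _ _ _) => [d|]; last by rewrite mulr0 addr0.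
  case: ifP => [/andP[/eqP d1 d2]|]; last by rewrite mulr0 addr0.
  rewrite /fillG /fill_op /= -(resS_some er) /=.
  move: nc; rewrite /closed_up /= -/x xa eqxx /= -(resS_some er) /= => /negPf ->.
  by rewrite exprS; ring.
rewrite expr0 mul1r in H; rewrite expr0 mul1r addrACA H addr0 /lact.
have -> : resS Sg Sm fs (x, x) = Some (b.1, b.1).
  by apply: (resS_push HF (e := (b.1, b.1)) ch); rewrite /isbas /= b1 subxx.
rewrite /= eqxx b12 -surjective_pairing.
case er: (resS _ _ _ _) => [d|]; last by rewrite add0r.
case: ifP => [/andP[/eqP d1 d2]|]; last by rewrite add0r.
by move: nxa; rewrite -(resS_some er) /= d1 eqxx.
Qed.

(** Injective maps neither create nor close gaps, so filling is compatible with every face of the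
    string. *)
Lemma dsimp_fill G c fs l b : valid c fs l b -> ~~ closed_up fs l b ->
  dsimp Sg Sm (fillG G) c fs l b =
  (-1) ^+ gap (push fs b.1) l * dsimp Sg Sm G c fs (fill (push fs b.1) l) b.
Proof.
move=> vl nc; have vf := valid_fill vl.
case: fs => [|f fs] in vl nc vf *; first by rewrite /dsimp mulr0.
rewrite (dsimp_bar HF _ vl) (dsimp_bar HF _ vf) mulrDr -barZ.
have /validP[ch al bb] := vl; have /and3P[b1 b2 b12] := bb.
congr (_ + _).
  have nc' : composable (push fs (pushB [:: f] b).1) l (push fs (pushB [:: f] b).2) = false.
    exact: negPf nc.
  by rewrite /fillG /fill_op nc'.
apply: eq_bar => [p x y d q el [<-]|p z el].
  rewrite /fillG /fill_op !(push_comp HF (c := c)) -?el //.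
  by move/negPf: nc; rewrite /closed_up => ->.
have [chp sz] : chain c p /\ src z = endp c p.
  by move: ch; rewrite el chain_rcons => /andP[? /eqP].
case: (resL_cases Sg Sm z l) => [[m am lm]|[a la an]]; last first.
  by rewrite (resL_none _ la an) (resL_none _ (mem_fill _ la) an) mulr0.
have p1 : push p b.1 \in Sg (src z) by rewrite sz (push_in HF).
have p2 : push p b.2 \in Sg (src z) by rewrite sz (push_in HF).
have [e1 e2 e3] := map_pushB_inj p1 p2 am.
rewrite lm (resL_push HF) // el push_rcons e1 (resL_push HF) ?all_isbas_fill // e2.
rewrite /fillG /fill_op -e3.
by move: nc; rewrite /closed_up el lm !push_rcons => /negPf ->.
Qed.

End Noncomposable.

(** * Composable tensors and the terminal object *)

Section Total.
Variables (k : fieldType) (C : fincat) (V : finType) (cbar : Ob C).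
Variables (Sg : Ob C -> {set {set V}}) (Sm : Mor C -> V -> V).
Hypotheses (HC : is_category C) (HF : is_functor_SimpComp Sg Sm).
Implicit Types (c : Ob C) (f g : Mor C) (fs : seq (Mor C)) (s t x y : {set V}).
Implicit Types (a b e : Bas V) (l m : seq (Bas V)) (xs ys : seq {set V}) (G : cofun k C V).
Implicit Types (xi : seq {set V} -> k).

Notation push := (push Sm).
Notation pushB := (pushB Sm).
Notation valid := (valid Sg).
Notation lact := (lact Sg Sm).
Notation ract := (ract Sg Sm).
Notation resL := (resL Sg Sm).
Notation closed_up := (closed_up Sm).
Notation Dfun := (Dfun Sg Sm).
Notation hoch := (hoch Sg Sm).
Notation dsimp := (dsimp Sg Sm).

Lemma eq_Dfun G G' c fs l b : valid c fs l b ->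
    (forall c' gs m d, valid c' gs m d -> closed_up gs m d = closed_up fs l b ->
      (size gs + size m).+1 = (size fs + size l)%N -> G c' gs m d = G' c' gs m d) ->
  Dfun G c fs l b = Dfun G' c fs l b.
Proof.
move=> vl e; rewrite /Dfun; congr (_ + _ * _).
  by apply: (eq_dsimp HC HF vl) => c1 gs m d vm cm sg sm; apply: e; rewrite // sm -sg addSn.
by apply: (eq_hoch vl) => m d vm cm sm; apply: e; rewrite // -sm addnS.
Qed.

Lemma dsimpZ r G c fs l b : valid c fs l b ->
  dsimp (fun c fs l b => r * G c fs l b) c fs l b = r * dsimp G c fs l b.
Proof.
case: fs => [|f fs] vl; first by rewrite /Defs.dsimp mulr0.
rewrite !(dsimp_bar HF _ vl) mulrDr -barZ; congr (_ + _).
by apply: eq_bar => // p z _; rewrite /resL; case: ifP => _; rewrite ?mulr0.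
Qed.

Lemma hochZ r G c fs l b : valid c fs l b ->
  hoch (fun c fs l b => r * G c fs l b) c fs l b = r * hoch G c fs l b.
Proof.
case: l => [|a l] vl; first by rewrite /Defs.hoch mulr0.
rewrite !(hoch_bar Sm _ vl) mulrDr -barZ; congr (_ + _).
  by rewrite /lact; case: resS => [e|]; first case: ifP => _; rewrite ?mulr0.
apply: eq_bar => // p z _.
by rewrite /ract; case: resS => [e|]; first case: ifP => _; rewrite ?mulr0.
Qed.

Lemma DfunZD r G G' c fs l b : valid c fs l b ->
  Dfun (fun c fs l b => r * G c fs l b + G' c fs l b) c fs l b =
  r * Dfun G c fs l b + Dfun G' c fs l b.
Proof. by move=> vl; rewrite /Dfun (hochZD _ _ _ _ vl) (dsimpZD HF _ _ _ vl); ring. Qed.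

Lemma Dfun0 c fs l b : valid c fs l b -> Dfun (fun _ _ _ _ => 0 : k) c fs l b = 0.
Proof.
move=> vl; set D := LHS; transitivity (-1 * D + D); last by rewrite mulN1r addNr.
by rewrite -DfunZD //; apply: (eq_Dfun vl) => *; rewrite mulr0 addr0.
Qed.

Lemma altdelZ (T : Type) (r : k) (g : seq T -> k) (w : seq T) :
  altdel (fun q => r * g q) w = r * altdel g w.
Proof.
elim: w g => [|a w IH] g; first by rewrite /altdel mulr0.
by rewrite -[LHS]/(_ - altdel (fun q => r * g (a :: q)) w) IH -mulrBr.
Qed.

(** * Composable tensors as flags *)

Lemma flag_cons2 (S : {set {set V}}) x y xs :
  flag S [:: x, y & xs] = [&& x \in S, x \subset y & flag S (y :: xs)].
Proof. by rewrite /flag /= /sub_rel -!andbA; do !bool_congr. Qed.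

Lemma flag_subseq (S : {set {set V}}) xs ys : subseq ys xs -> flag S xs -> flag S ys.
Proof. by move=> yx fx; apply: bisimp_flag (bisimp_subseq yx (bisimp0 fx)). Qed.

Lemma flag_last (S : {set {set V}}) x xs : flag S (x :: xs) ->
  last x xs \in S /\ x \subset last x xs.
Proof.
elim: xs x => [|y xs IH] x; first by rewrite /flag /= andbT => ->.
rewrite flag_cons2 => /and3P[xS xy /IH[yS yl]]; split=> //.
exact: subset_trans xy yl.
Qed.

Lemma flag_head (S : {set {set V}}) x xs : flag S (x :: xs) -> x \in S.
Proof. by case/andP=> _ /andP[]. Qed.

Lemma flag_tail (S : {set {set V}}) x xs : flag S (x :: xs) -> flag S xs.
Proof. by apply: flag_subseq; apply: subseq_cons. Qed.

Lemma flag_push c fs xs : chain c fs -> flag (Sg c) xs ->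
  flag (Sg (endp c fs)) (map (push fs) xs).
Proof.
move=> ch; elim: xs => [//|x [|y xs] IH].
  by rewrite /flag /= !andbT => xS; apply: (push_in HF).
rewrite [map _ _]/= !flag_cons2 => /and3P[xS xy fl].
have yS := flag_head fl; rewrite (push_in HF) //= (push_sub HF ch) // xy /=.
exact: IH.
Qed.

Fixpoint pairs x xs : seq (Bas V) :=
  if xs is y :: ys then (x, y) :: pairs y ys else [::].

Lemma composable_pairs x xs : composable x (pairs x xs) (last x xs).
Proof. by elim: xs x => [|y xs IH] x /=; rewrite ?eqxx ?IH. Qed.

Lemma size_pairs x xs : size (pairs x xs) = size xs.
Proof. by elim: xs x => [|y xs IH] x //=; rewrite IH. Qed.

Lemma map_snd_pairs x xs : map snd (pairs x xs) = xs.
Proof. by elim: xs x => [|y xs IH] x //=; rewrite IH. Qed.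

Lemma map_pairs f x xs :
  map (pushB [:: f]) (pairs x xs) = pairs (Sm f @: x) (map (fun s => Sm f @: s) xs).
Proof. by elim: xs x => [|y xs IH] x //=; rewrite IH. Qed.

Lemma composable_is_pairs x l y : composable x l y ->
  l = pairs x (map snd l) /\ last x (map snd l) = y.
Proof.
elim: l x => [|a l IH] x /=; first by move/eqP.
by case/andP=> /eqP-> /IH[<- ->]; rewrite -surjective_pairing.
Qed.

Lemma isbas_pairs (S : {set {set V}}) x xs : x \in S ->
  all (isbas S) (pairs x xs) = flag S (x :: xs).
Proof.
elim: xs x => [|y xs IH] x xS; first by rewrite /flag /= xS.
rewrite flag_cons2 /= xS /isbas /= xS /=.
case yS: (y \in S) => /=; first by rewrite IH.
by apply/esym/negP=> /andP[_ /flag_head]; rewrite yS.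
Qed.

(* By [closed_up_flag], these are the values at all composable basis tensors. *)
Definition on_flag G c fs xs : k :=
  if xs is x :: xs' then
    G c fs (pairs (push fs x) (map (push fs) xs')) (x, last x xs') else 0.

Lemma valid_on_flag c fs x xs : chain c fs -> flag (Sg c) (x :: xs) ->
  valid c fs (pairs (push fs x) (map (push fs) xs)) (x, last x xs).
Proof.
move=> ch fl; have xS := flag_head fl; have [lS xl] := flag_last fl.
apply/validP; split=> //; last by apply/and3P.
by rewrite isbas_pairs ?(push_in HF) //; apply: (flag_push ch fl).
Qed.

Lemma closed_up_on_flag fs x xs :
  closed_up fs (pairs (push fs x) (map (push fs) xs)) (x, last x xs).
Proof. by rewrite /closed_up /= -last_map composable_pairs. Qed.

Lemma closed_up_flag c fs l b : valid c fs l b -> closed_up fs l b ->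
  exists x xs, [/\ flag (Sg c) (x :: xs),
    l = pairs (push fs x) (map (push fs) xs) & b = (x, last x xs)].
Proof.
case: b => u v /validP[ch al /and3P[/= uS vS uv]] /composable_is_pairs[/=].
set zs := map snd l => el elast.
have fz : flag (Sg (endp c fs)) (push fs u :: zs).
  by rewrite -isbas_pairs -?el // (push_in HF).
(* The walk ends at [push fs v], so each of its members is a face of that simplex and lifts by
   [push_lower]. *)
have [xs xsS exs] : exists2 xs, all (mem (Sg c)) xs & zs = map (push fs) xs.
  move: (push fs u) fz elast {el}; elim: zs => [|z zs' IH] w fw ew.
    by exists [::].
  have fz := flag_tail fw; have [xs xsS ->] := IH z fz ew.
  have [_ zl] := flag_last fz; rewrite /= in ew; rewrite ew in zl.
  have [x xS ->] := push_lower HF ch vS zl (simp_neq0 (simpcomp HF _) (flag_head fz)).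
  by exists (x :: xs); rewrite //= xS.
rewrite exs in fz el elast.
have ev : last u xs = v.
  have lS : last u xs \in Sg c.
    by have := mem_last u xs; rewrite inE => /orP[/eqP->|/(allP xsS)].
  by apply/eqP; rewrite -(push_eq HF ch) // -last_map elast.
exists u, xs; rewrite ev; split=> //.
move: fz; rewrite /flag /= uS xsS !andbT => /andP[+ _] {el elast ev}.
elim: xs u uS xsS {uv exs} => [//|x xs IH] u uS /= /andP[xS xsS] /andP[ux /IH->] //.
by rewrite andbT; move: ux; rewrite /sub_rel (push_sub HF ch).
Qed.

(** Deleting the first, an inner or the last member of the flag is the left action, a product or the
    right action; the actions also move the ends of [b], which are those of the flag. *)
Lemma hoch_on_flag G c fs x xs : chain c fs -> flag (Sg c) (x :: xs) ->
  hoch G c fs (pairs (push fs x) (map (push fs) xs)) (x, last x xs) =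
  altdel (on_flag G c fs) (x :: xs).
Proof.
move=> ch fl.
(* [u] is kept apart from [y] because only the face of index 0 moves the left end of the
   coefficient. *)
have bar_pairs (u : {set V}) (K : seq (Bas V) -> Bas V -> k) y ys :
    u \subset y -> flag (Sg c) (y :: ys) ->
  bar (@mulB V) (fun m => K m (u, last y ys)) (fun z m => ract fs z (K m) (u, last y ys))
    (pairs (push fs y) (map (push fs) ys)) =
  - altdel (fun zs => K (pairs (push fs y) (map (push fs) zs)) (u, last y zs)) ys.
  elim: ys y K => [|z ys IH] y K uy fy; first by rewrite /bar /altdel oppr0.
  have [yS yz fz] := and3P (etrans (esym (flag_cons2 _ _ _ _)) fy).
  have zS := flag_head fz.
  case: ys IH fz fy => [|w ys] IH fz fy.
    rewrite bar1 /altdel subr0 /ract.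
    have := resS_push HF (e := (y, z)) ch; rewrite {1}/pushB /= => -> /=.
      by rewrite eqxx uy.
    by apply/and3P.
  rewrite [pairs _ _]/= bar_cons2 {1}/mulB /= eqxx.
  rewrite -[X in - (_ + X)]/(bar _ _ _ (pairs (push fs z) (map (push fs) (w :: ys)))).
  rewrite (IH z (fun m => K ((push fs y, push fs z) :: m))) //; last exact: subset_trans uy yz.
(* For a single member both sides are 0, thanks to the value 0 of [on_flag] on the empty flag. *)
case: xs fl => [|y xs] fl; first by rewrite /altdel /hoch subr0.
have vl := valid_on_flag ch fl.
rewrite (hoch_bar Sm _ vl).
have [xS xy fy] := and3P (etrans (esym (flag_cons2 _ _ _ _)) fl).
have [lS yl] := flag_last fy.
congr (_ + _).
  rewrite /lact; have := resS_push HF (e := (x, y)) ch; rewrite {1}/pushB /= => -> /=.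
    by rewrite eqxx yl.
  by rewrite /isbas /= xS xy (flag_head fy).
exact: (bar_pairs x (G c fs) x (y :: xs)).
Qed.

Lemma map_push_comp c p f g q xs : chain c (p ++ f :: g :: q) -> flag (Sg c) xs ->
  map (push (p ++ Defs.comp g f :: q)) xs = map (push (p ++ f :: g :: q)) xs.
Proof.
move=> ch /andP[_ /allP al]; apply/eq_in_map => x /al xS.
exact: (push_comp HF ch).
Qed.

(** Restricting a pushed flag along the last arrow gives the same flag pushed one step less, so the
    last face merely forgets that arrow. *)
Lemma dsimp_on_flag G c f fs x xs : chain c (f :: fs) -> flag (Sg c) (x :: xs) ->
  dsimp G c (f :: fs) (pairs (push (f :: fs) x) (map (push (f :: fs)) xs)) (x, last x xs) =
  on_flag G (tgt f) fs (map (fun s => Sm f @: s) (x :: xs)) +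
  bar (@compop C) (fun gs => on_flag G c gs (x :: xs))
    (fun _ gs => on_flag G c gs (x :: xs)) (f :: fs).
Proof.
move=> ch fl; have vl := valid_on_flag ch fl.
rewrite (dsimp_bar HF _ vl); congr (_ + _).
  by rewrite /= last_map -map_comp.
apply: eq_bar => [p g h d q el [<-]|p z el].
  have := map_push_comp (p := p) (f := g) (g := h) (q := q) (c := c) _ fl.
  by rewrite -el => /(_ ch)[e1 e2]; rewrite /on_flag e1 e2.
move: ch; rewrite el chain_rcons => /andP[chp /eqP sz].
have e y : push (rcons p z) y = Sm z @: push p y by apply: push_rcons.
have e' : map (push (rcons p z)) xs = map (fun s => Sm z @: s) (map (push p) xs).
  by rewrite -map_comp; apply: eq_map.
rewrite e e' -map_pairs (resL_push HF) //.
by case/validP: (valid_on_flag chp fl); rewrite sz.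
Qed.

(** * Contraction along the arrows to the terminal object *)

Hypothesis Hterm : is_terminal cbar.

Definition termor c : Mor C :=
  odflt (idm c) [pick f | (src f == c) && (tgt f == cbar)].

Lemma termorP c : src (termor c) = c /\ tgt (termor c) = cbar.
Proof.
rewrite /termor; case: pickP => [f /andP[/eqP ? /eqP] //|no].
by have [f [[sf tf] _]] := Hterm c; have := no f; rewrite sf tf !eqxx.
Qed.

Lemma termor_uniq f : tgt f = cbar -> f = termor (src f).
Proof.
move=> tf; have [h [_ u]] := Hterm (src f).
exact: etrans (esym (u f (conj erefl tf))) (u _ (termorP (src f))).
Qed.

Lemma comp_termor f : Defs.comp (termor (tgt f)) f = termor (src f).
Proof.
have [st tt] := termorP (tgt f); case: HC => _ /(_ f (termor (tgt f)) (esym st)) [e1 e2] _ _.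
by rewrite -e1 -termor_uniq ?e2.
Qed.

Lemma termor_id : termor cbar = idm cbar.
Proof.
by case: HC => /(_ cbar)[s t] _ _ _; rewrite -{1}s -termor_uniq.
Qed.

Definition to_cbar c s := Sm (termor c) @: s.

Lemma to_cbar_comp f s : s \in Sg (src f) -> to_cbar (tgt f) (Sm f @: s) = to_cbar (src f) s.
Proof.
move=> sS; rewrite /to_cbar -(Sm_comp HF) ?comp_termor //.
by case: (termorP (tgt f)).
Qed.

Lemma chain_termor c fs : chain c fs -> chain c (rcons fs (termor (endp c fs))).
Proof. by rewrite chain_rcons => ->; case: (termorP (endp c fs)) => -> _ /=. Qed.

Lemma flag_to_cbar c xs : flag (Sg c) xs -> flag (Sg cbar) (map (to_cbar c) xs).
Proof.
have [sc tc] := termorP c; move=> fl.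
have ch : chain c [:: termor c] by rewrite /= sc eqxx.
by have := flag_push ch fl; rewrite /= tc.
Qed.

(** Each sign is the one carried in [Dfun] by the term that gives back [G]: the last face of the
    lengthened string, or the Hochschild direction. *)
Definition homot G : cofun k C V := fun c fs l b =>
  if closed_up fs l b then
    (-1) ^+ (size fs).+1 *
      G c (rcons fs (termor (endp c fs))) (map (pushB [:: termor (endp c fs)]) l) b
  else (-1) ^+ size fs * fillG Sm G c fs l b.

(* Flags of the simplicial complexes of the diagram are moved into that of the
   terminal object, where [xi] lives. *)
Definition spread xi : cofun k C V := fun c fs l b =>
  if (fs == [::]) && closed_up fs l b
  then xi (map (to_cbar c) (b.1 :: map snd l)) else 0.

Lemma on_flag_homot G c fs xs :
  on_flag (homot G) c fs xs =
  (-1) ^+ (size fs).+1 * on_flag G c (rcons fs (termor (endp c fs))) xs.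
Proof.
case: xs => [|x xs]; rewrite /on_flag ?mulr0 // /homot closed_up_on_flag map_pairs.
rewrite -push_rcons -map_comp; congr (_ * G _ _ (pairs _ _) _).
by apply: eq_map => y; rewrite push_rcons.
Qed.

Lemma on_flag_spread xi c xs : xi [::] = 0 ->
  on_flag (spread xi) c [::] xs = xi (map (to_cbar c) xs).
Proof.
case: xs => [|x xs] // _; rewrite /on_flag /spread closed_up_on_flag /=.
by rewrite map_snd_pairs map_id.
Qed.

Lemma on_flag_spread0 xi c f fs xs : on_flag (spread xi) c (f :: fs) xs = 0.
Proof. by case: xs. Qed.

(** By uniqueness, an arrow followed by the arrow to [cbar] is again the arrow to [cbar]. That
    composite supplies the lengthened last face of [f :: fs]; only the face dropping the new arrow
    is extra. *)
Lemma bar_termor (K : seq (Mor C) -> k) c f fs : chain c (f :: fs) ->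
  bar (@compop C) K (fun=> K) (rcons (f :: fs) (termor (endp c (f :: fs)))) =
  bar (@compop C) (fun gs => K (rcons gs (termor (endp c gs))))
    (fun _ gs => K (rcons gs (termor (endp c gs)))) (f :: fs)
  + (-1) ^+ (size fs).+2 * K (f :: fs).
Proof.
elim: fs c f K => [|g fs IH] c f K.
  move=> /= /andP[/eqP<- _]; rewrite bar_cons2 !bar1 /= comp_termor; ring.
move=> /andP[/eqP sf ch]; rewrite [rcons _ _]/= !bar_cons2 /compop.
rewrite -[bar _ _ _ (g :: rcons _ _)]/(bar _ _ _ (rcons (g :: fs) (termor (endp (tgt f) (g :: fs))))).
rewrite (IH (tgt f) g (fun gs => K (f :: gs)) ch) /=.
case/andP: ch => /eqP sg _; case: HC => _ /(_ f g (esym sg))[_ ->] _ _.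
by rewrite !exprS; ring.
Qed.

(** The contraction fails only for composable tensors over strings of length 0: there the face of
    index 0 of the added arrow evaluates [G] over [cbar], which is the [spread] term. *)
Lemma homotP G : (forall c fs l b, valid c fs l b -> Dfun G c fs l b = 0) ->
  forall c fs l b, valid c fs l b ->
  Dfun (homot G) c fs l b + spread (on_flag G cbar [::]) c fs l b = G c fs l b.
Proof.
move=> G0 c fs l b vl; case cl : (closed_up fs l b); last first.
  rewrite /spread cl andbF addr0 /Dfun.
  have nc := negbT cl.
  have -> : dsimp (homot G) c fs l b = - (-1) ^+ size fs * dsimp (fillG Sm G) c fs l b.
    rewrite -dsimpZ //; apply: (eq_dsimp HC HF vl) => c' gs q d _ cq <- _.
    by rewrite /homot cq cl exprS; ring.
  have -> : hoch (homot G) c fs l b = (-1) ^+ size fs * hoch (fillG Sm G) c fs l b.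
    by rewrite -hochZ //; apply: (eq_hoch vl) => q d _ cq _; rewrite /homot cq cl.
  have := G0 _ _ _ _ (valid_fill HF vl); rewrite /Dfun => /eqP; rewrite addr_eq0 => /eqP e.
  rewrite (dsimp_fill HF) // e -[RHS](hoch_fill HF G vl nc) [X in _ + X = _]mulrA signK mul1r addrC.
  by congr (_ + _); rewrite mulrN mulrN mulNr opprK mulrCA [X in _ * X]mulrA signK mul1r.
have ch : chain c fs by case/validP: vl.
have [x [xs [fl -> ->]]] := closed_up_flag vl cl.
rewrite /Dfun (hoch_on_flag _ ch fl) -/(on_flag G c fs (x :: xs)).
have -> : altdel (on_flag (homot G) c fs) (x :: xs) =
    (-1) ^+ (size fs).+1 * altdel (on_flag G c (rcons fs (termor (endp c fs)))) (x :: xs).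
  by rewrite -altdelZ; apply: eq_altdel => ys _ _; apply: on_flag_homot.
have cht := chain_termor ch; have vt := valid_on_flag cht fl.
have := G0 _ _ _ _ vt; rewrite /Dfun (hoch_on_flag _ cht fl) size_rcons.
have [st tt] := termorP c.
case: fs => [|f fs] in ch cht vl cl vt *.
  rewrite [rcons _ _]/= dsimp_on_flag // bar1 tt expr1 mulN1r => /eqP.
  rewrite subr_eq0 => /eqP <-; rewrite /Defs.dsimp expr0 mul1r add0r.
  rewrite -/(on_flag (spread (on_flag G cbar [::])) c [::] (x :: xs)) on_flag_spread // /to_cbar; ring.
rewrite [rcons _ _]/= dsimp_on_flag // -rcons_cons (bar_termor (fun gs => on_flag G c gs (x :: xs)) ch) => h.
rewrite dsimp_on_flag // on_flag_homot.
rewrite -/(on_flag (spread _) c (f :: fs) (x :: xs)) on_flag_spread0 addr0.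
set E := altdel _ _ in h *; set K := on_flag G c (f :: fs) (x :: xs) in h *.
set A := on_flag G _ _ _ in h *.
have -> : bar (@compop C) (fun gs => on_flag (homot G) c gs (x :: xs))
    (fun _ gs => on_flag (homot G) c gs (x :: xs)) (f :: fs) =
  (-1) ^+ (size fs).+1 * bar (@compop C)
    (fun gs => on_flag G c (rcons gs (termor (endp c gs))) (x :: xs))
    (fun _ gs => on_flag G c (rcons gs (termor (endp c gs))) (x :: xs)) (f :: fs).
  rewrite -barZ; apply: eq_bar => [p y z d q el [<-]|p z el]; rewrite on_flag_homot.
    by congr (_ ^+ _ * _); move/(congr1 size): el; rewrite !size_cat /= !addnS => -[->].
  by congr (_ ^+ _ * _); move/(congr1 size): el; rewrite size_rcons /= => <-.
set B := bar _ _ _ _ in h *.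
have {}h : A + B = (-1) ^+ (size fs).+1 * (K + E).
  apply/eqP; rewrite -subr_eq0 -[X in _ == X]h /= !exprS; apply/eqP; ring.
have s2 (n : nat) r : (-1) ^+ n * ((-1) ^+ n.+1 * r) = - r :> k.
  by rewrite exprS mulN1r mulNr mulrN mulrA signK mul1r.
by rewrite -mulrDr h s2 [X in X + _]mulrA signK mul1r addrK.
Qed.

Lemma eq_spread xi eta c fs l b : valid c fs l b ->
    (forall xs, flag (Sg cbar) xs -> xi xs = eta xs) ->
  spread xi c fs l b = spread eta c fs l b.
Proof.
rewrite /spread => vl e; case: eqP => //= f0; case: ifP => // cl; apply: e.
have [x [xs [fl -> ->]]] := closed_up_flag vl cl.
by rewrite f0 /= map_snd_pairs map_id; apply: (flag_to_cbar fl).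
Qed.

(** On strings of length 1 the two faces cancel by [to_cbar_comp], and on longer ones every face
    still contains an arrow. So [spread] is a cochain map. *)
Lemma spread_altdel xi c fs l b : xi [::] = 0 -> valid c fs l b ->
  Dfun (spread xi) c fs l b = spread (altdel xi) c fs l b.
Proof.
move=> xi0 vl; case cl : (closed_up fs l b); last first.
  rewrite [RHS]/spread cl andbF -(Dfun0 vl); apply: (eq_Dfun vl) => c' gs m d _ cm _.
  by rewrite /spread cm cl andbF.
have ch : chain c fs by case/validP: vl.
have [x [xs [fl -> ->]]] := closed_up_flag vl cl.
rewrite -/(on_flag (spread (altdel xi)) c fs (x :: xs)) /Defs.Dfun (hoch_on_flag _ ch fl).
case: fs => [|f fs] in ch {vl cl} *.
  rewrite /Defs.dsimp add0r expr0 mul1r on_flag_spread // altdel_map.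
  by apply: eq_altdel => ys _ _; apply: on_flag_spread.
rewrite on_flag_spread0 dsimp_on_flag //.
rewrite (@eq_altdel _ _ _ (fun=> 0)) => [|ys _ _]; last exact: on_flag_spread0.
rewrite altdel0 mulr0 addr0; case: fs => [|g fs] in ch *.
  have sf : c = src f by case/andP: ch => /eqP.
  rewrite bar1 !on_flag_spread // -map_comp; apply/eqP; rewrite subr_eq0; apply/eqP.
  congr xi; apply/eq_in_map => y /= yx; rewrite sf to_cbar_comp // -sf.
  by case/andP: fl => _ /allP; apply.
rewrite on_flag_spread0 add0r -[RHS](bar0 k (@compop C) [:: f, g & fs]).
apply: eq_bar => [[|p0 p] y z d q el|[|p0 [|p1 p]] z el]; rewrite ?on_flag_spread0 //.
Qed.

End Total.

(** * Coordinates *)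

Section Coordinates.
Variables (k : fieldType) (C : fincat) (V : finType).
Variables (Sg : Ob C -> {set {set V}}) (Sm : Mor C -> V -> V).
Hypotheses (HC : is_category C) (HF : is_functor_SimpComp Sg Sm).
Implicit Types (c : Ob C) (fs : seq (Mor C)) (l : seq (Bas V)) (b : Bas V) (G : cofun k C V).

Lemma decode_inj n (i j : Idx Sg n) : decode (val i) = decode (val j) -> i = j.
Proof.
case: i j => [[[c b] [p [t u]]] vi] [[[c' b'] [p' [t' u']]] vj] /=.
rewrite /decode /= => -[ec et eu eb]; apply: val_inj => /=.
have ep : p = p' by apply: val_inj; rewrite -[LHS](size_tuple t) et size_tuple.
by case: p' / ep t' u' vj et eu => t' u' vj /val_inj-> /val_inj->; rewrite ec eb.
Qed.

Lemma decode_surj n c fs l b : valid Sg c fs l b -> (size fs + size l)%N = n ->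
  exists i : Idx Sg n, decode (val i) = (c, fs, l, b).
Proof.
move=> vl sz; have pn : (size fs < n.+1)%N by rewrite ltnS -sz leq_addr.
have sl : size l == (n - Ordinal pn)%N by rewrite /= -sz addKn.
pose ti : TIdx C V n := Tagged (fun p : 'I_n.+1 => ((p.-tuple (Mor C)) * ((n - p).-tuple (Bas V)))%type)
  (Tuple (eqxx (size fs) : size fs == Ordinal pn), Tuple sl).
have vi : validD Sg (decode ((c, b), ti)) by [].
by exists (Sub ((c, b), ti) vi).
Qed.

Lemma decode_valid n (i : Idx Sg n) c fs l b : decode (val i) = (c, fs, l, b) ->
  valid Sg c fs l b /\ (size fs + size l)%N = n.
Proof.
move=> e; split; first by have := valP i; rewrite e.
case: i e => [[[c' b'] [p [t u]]] vi]; rewrite /decode /= => -[_ <- <- _].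
by rewrite !size_tuple subnKC // -ltnS.
Qed.

Lemma ev_decode n (x : Cochains k Sg n) (i : Idx Sg n) c fs l b :
  decode (val i) = (c, fs, l, b) -> ev x c fs l b = x i.
Proof.
move=> e; rewrite /ev; case: pickP => [j /eqP ej|/(_ i)]; last by rewrite e eqxx.
by congr (x _); apply: decode_inj; rewrite ej e.
Qed.

Lemma ev_degree n (x : Cochains k Sg n) c fs l b :
  (size fs + size l)%N != n -> ev x c fs l b = 0.
Proof.
move=> nn; rewrite /ev; case: pickP => // i /eqP/decode_valid[_ e].
by rewrite e eqxx in nn.
Qed.

Definition of_cofun n G : Cochains k Sg n :=
  [ffun i => let: (c, fs, l, b) := decode (val i) in G c fs l b].

Lemma ev_of_cofun n G c fs l b : valid Sg c fs l b -> (size fs + size l)%N = n ->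
  ev (of_cofun n G) c fs l b = G c fs l b.
Proof.
by move=> vl sz; have [i e] := decode_surj vl sz; rewrite (ev_decode _ e) ffunE e.
Qed.

Lemma Dtot_decode n (x : Cochains k Sg n) i c fs l b :
  decode (val i) = (c, fs, l, b) -> Dtot Sm x i = Dfun Sg Sm (ev x) c fs l b.
Proof. by move=> e; rewrite ffunE e. Qed.

Lemma ev_Dtot n (x : Cochains k Sg n) c fs l b : valid Sg c fs l b ->
  ev (Dtot Sm x) c fs l b = Dfun Sg Sm (ev x) c fs l b.
Proof.
move=> vl; case: (eqVneq (size fs + size l)%N n.+1) => [sz|nz].
  by have [i e] := decode_surj vl sz; rewrite (ev_decode _ e) (Dtot_decode _ e).
rewrite ev_degree // -[LHS](Dfun0 k HC HF vl); apply: (eq_Dfun HC HF vl) => c' gs m d _ _ sz.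
by rewrite ev_degree // -(inj_eq succn_inj) sz.
Qed.

Lemma Dfun_cocycle n (x : Cochains k Sg n) : isCocycle Sm x ->
  forall c fs l b, valid Sg c fs l b -> Dfun Sg Sm (ev x) c fs l b = 0.
Proof.
move=> xc c fs l b vl; rewrite -ev_Dtot // xc /ev.
by case: pickP => // i _; rewrite ffunE.
Qed.

(** [G] may be inhomogeneous, since by [eq_Dfun] only its part one degree lower is read. In degree 0
    the differential has no terms, so [x] is 0. *)
Lemma isCobound_ev n (x : Cochains k Sg n) G :
    (forall c fs l b, valid Sg c fs l b -> ev x c fs l b = Dfun Sg Sm G c fs l b) ->
  isCobound Sm x.
Proof.
case: n x => [|n] x xG.
  apply/ffunP=> i; rewrite [RHS]ffunE; case e : (decode (val i)) => [[[c fs] l] b].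
  have [vl /eqP] := decode_valid e; rewrite -(ev_decode x e) xG // addn_eq0.
  case/andP=> /nilP-> /nilP->; by rewrite /Dfun /hoch /dsimp mulr0 addr0.
exists (of_cofun n G); apply/ffunP=> i; case e : (decode (val i)) => [[[c fs] l] b].
have [vl sz] := decode_valid e.
rewrite -(ev_decode x e) xG // (Dtot_decode _ e); apply: (eq_Dfun HC HF vl).
by move=> c' gs m d vm _ em; apply: ev_of_cofun; rewrite // -(succn_inj (etrans em sz)).
Qed.

Lemma isCocycle_of_cofun n G :
    (forall c fs l b, valid Sg c fs l b -> Dfun Sg Sm G c fs l b = 0) ->
  isCocycle Sm (of_cofun n G).
Proof.
move=> G0; apply/ffunP=> i; rewrite [RHS]ffunE.
case e : (decode (val i)) => [[[c fs] l] b]; have [vl sz] := decode_valid e.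
rewrite (Dtot_decode _ e) -(G0 _ _ _ _ vl); apply: (eq_Dfun HC HF vl).
by move=> c' gs m d vm _ em; apply: ev_of_cofun; rewrite // -(succn_inj (etrans em sz)).
Qed.

End Coordinates.

(** * Coordinates of simplicial cochains *)

Section SimplicialCoordinates.
Variables (k : fieldType) (V : finType) (S : {set {set V}}) (HS : is_simpcomp S).
Implicit Types (s t : {set V}) (w : {set V} -> k).

Lemma SIdx_mk q s : s \in S -> #|s| = q.+1 -> exists i : SIdx S q, val i = s.
Proof. 
move=> sS /eqP sq; have h : (s \in S) && (#|s| == q.+1) by rewrite sS.
by exists (Sub s h).
Qed.

Lemma sev_val q (x : SCochains k S q) (i : SIdx S q) : sev x (val i) = x i.
Proof.
rewrite /sev; case: pickP => [j /eqP/val_inj-> //|/(_ i)]; by rewrite eqxx.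
Qed.

Lemma sev_out q (x : SCochains k S q) s : ~~ ((s \in S) && (#|s| == q.+1)) -> sev x s = 0.
Proof. by move=> n; rewrite /sev; case: pickP => // i /eqP e; rewrite -e (valP i) in n. Qed.

Lemma sev_set0 q (x : SCochains k S q) : sev x set0 = 0.
Proof. by apply: sev_out; rewrite cards0 andbF. Qed.

Definition of_simp q w : SCochains k S q := [ffun i => w (val i)].

Lemma sev_of_simp q w s : s \in S -> #|s| = q.+1 -> sev (of_simp q w) s = w s.
Proof. by move=> sS sq; have [i <-] := SIdx_mk sS sq; rewrite sev_val ffunE. Qed.

Lemma sdelta_bd q (x : SCochains k S q) i : sdelta x i = bd (sev x) (val i).
Proof. by rewrite ffunE bdE. Qed.

Lemma simp_face s t q : s \in S -> #|s| = q.+2 -> t \subset s -> #|t|.+1 = #|s| ->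
  t \in S /\ #|t| = q.+1.
Proof.
move=> sS sq ts; rewrite sq => -[tq]; split=> //.
by apply: (simp_sub HS sS ts); rewrite -card_gt0 tq.
Qed.

Lemma sdelta_of_simp q w i : sdelta (of_simp q w) i = bd w (val i).
Proof.
rewrite sdelta_bd; have /andP[sS /eqP sq] := valP i.
apply: eq_bd => t ts ct; have [tS tq] := simp_face sS sq ts ct.
exact: sev_of_simp.
Qed.

(** The condition at [set0] settles degree 0, where [bd w] is the constant [w set0] while the only
    coboundary is 0. *)
Lemma isSCobound_bd q w : w set0 = 0 ->
    forall x : SCochains k S q, (forall i, x i = bd w (val i)) -> isSCobound x.
Proof.
move=> w0; case: q => [|q] x xw.
  apply/ffunP=> i; rewrite xw [RHS]ffunE; have /andP[_ /eqP s1] := valP i.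
  rewrite (@eq_bd _ _ _ (fun=> 0)) ?bd0 // => t _; rewrite s1 => -[/eqP].
  by rewrite cards_eq0 => /eqP->.
by exists (of_simp q w); apply/ffunP=> i; rewrite sdelta_of_simp xw.
Qed.

Lemma isSCobound_sev q (x : SCochains k S q) : isSCobound x ->
  exists2 w, w set0 = 0 & forall s, s \in S -> sev x s = bd w s.
Proof.
case: q x => [|q] x; first move=> ->.
  exists (fun=> 0) => // s _; rewrite bd0 /sev; case: pickP => // i _; by rewrite ffunE.
case=> y <-; exists (sev y); first exact: sev_set0.
move=> s sS; case: (eqVneq #|s| q.+2) => [sq|nq].
  by have [i <-] := SIdx_mk sS sq; rewrite sev_val sdelta_bd.
rewrite sev_out ?(negPf nq) ?andbF // (@eq_bd _ _ _ (fun=> 0)) ?bd0 // => t _ ct.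
by rewrite sev_out // -(inj_eq succn_inj) ct (negPf nq) andbF.
Qed.

End SimplicialCoordinates.

(** * The comparison map and its four properties *)

Theorem theorem5p11 (k : fieldType) (C : fincat) (cbar : Ob C) (V : finType)
    (Sg : Ob C -> {set {set V}}) (Sm : Mor C -> V -> V)
    (HC : is_category C) (Hterm : is_terminal cbar)
    (HF : is_functor_SimpComp Sg Sm) (q : nat) :
  exists f : {linear @Cochains k C V Sg q -> @SCochains k V (Sg cbar) q},
    induces_coh_iso (@isCocycle k C V Sg Sm q) (@isCobound k C V Sg Sm q)
      (@isSCocycle k V (Sg cbar) q) (@isSCobound k V (Sg cbar) q) f.
Proof.
pose HS := simpcomp HF cbar.
(* The component at the string of length 0 over [cbar], read on flags. *)
pose res n (x : Cochains k Sg n) := on_flag Sm (ev x) cbar [::].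
pose F (x : Cochains k Sg q) : SCochains k (Sg cbar) q := of_simp _ q (subdiv (res q x)).
have evZD a (x y : Cochains k Sg q) c fs l b :
    ev (a *: x + y) c fs l b = a * ev x c fs l b + ev y c fs l b.
  by rewrite /ev; case: pickP => [i _|_]; rewrite ?mulr0 ?addr0 // !ffunE.
have FL : linear F.
  move=> a x y; apply/ffunP=> i; rewrite !ffunE; apply: subdivZD => -[|s l] /=.
    by rewrite mulr0 addr0.
  exact: evZD.
pose fl : {linear Cochains k Sg q -> SCochains k (Sg cbar) q} :=
  HB.pack F (GRing.isLinear.Build _ _ _ _ F FL).
exists fl.
have res_altdel n (x : Cochains k Sg n) xs : flag (Sg cbar) xs ->
    altdel (res n x) xs = on_flag Sm (Dfun Sg Sm (ev x)) cbar [::] xs.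
  case: xs => [//|s xs] fs; rewrite /on_flag /Dfun /dsimp add0r expr0 mul1r.
  by rewrite (hoch_on_flag HF _ (fs := [::])).
have res_deg n (x : Cochains k Sg n) xs : size xs != n.+1 -> res n x xs = 0.
  case: xs => [//|s xs] /= nn; rewrite /res /= ev_degree //.
  by rewrite size_pairs size_map.
have res_cocycle (x : Cochains k Sg q) : isCocycle Sm x ->
    forall xs, flag (Sg cbar) xs -> altdel (res q x) xs = 0.
  move=> xc xs fx; rewrite res_altdel //; case: xs fx => [//|s xs] fx.
  by apply: (Dfun_cocycle HC HF xc); apply: (valid_on_flag HF (fs := [::])).
have res_cobound n (x : Cochains k Sg n) : isCobound Sm x ->
    exists2 eta : seq {set V} -> k, eta [::] = 0 &
      forall xs, flag (Sg cbar) xs -> res n x xs = altdel eta xs.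
  case: n x => [|n] x /=; first move=> ->.
    exists (fun=> 0) => // xs _; rewrite altdel0; case: xs => [//|s xs].
    by rewrite /res /= /ev; case: pickP => // i _; rewrite ffunE.
  case=> y <-; exists (res n y) => // xs fx; rewrite res_altdel //.
  case: xs fx => [//|s xs] fx; rewrite /res /on_flag (ev_Dtot HC HF) //.
  exact: (valid_on_flag HF (fs := [::])).
split.
- move=> x xc; apply/ffunP=> i; rewrite (sdelta_of_simp HS) [RHS]ffunE.
  have /andP[sS _] := valP i; exact: (subdiv_cocycle HS (res_cocycle x xc)).
- move=> x /res_cobound[eta eta0 xe].
  have [w w0 ew] := subdiv_cobound HS (erefl : res q x [::] = 0) eta0 xe.
  apply: (isSCobound_bd HS w0) => i; rewrite ffunE; apply: ew.
  by have /andP[] := valP i.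
- move=> x xc /isSCobound_sev[w w0 ew].
  (* [subdiv_inj] asks for the equation in all degrees; outside degree [q] the restriction of [x]
     vanishes, and so does its subdivision. *)
  have sw s : s \in Sg cbar -> subdiv (res q x) s = bd w s.
    move=> sS; rewrite -ew //; case: (eqVneq #|s| q.+1) => [sq|nq].
      by rewrite sev_of_simp.
    rewrite sev_out ?(negPf nq) ?andbF // (subdiv_degree HS (m := #|s|)) // => xs _ sx.
    by apply: res_deg; rewrite sx.
  have [eta eta0 xe] := subdiv_inj HS (erefl : res q x [::] = 0) w0 (res_cocycle x xc) sw.
  (* [homot] recovers [x] up to the spread of its restriction, which is the coboundary of the spread
     of [eta]. The factor 1 gives the shape of [DfunZD]. *)
  pose G := fun c fs l b => 1 * homot cbar Sm (ev x) c fs l b + spread cbar Sm eta c fs l b.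
  apply: (isCobound_ev HC HF (G := G)) => c fs l b vl.
  rewrite (DfunZD HF _ _ _ vl) mul1r (spread_altdel HC HF Hterm eta0 vl).
  rewrite -(eq_spread HF Hterm vl xe).
  by rewrite (homotP HC HF Hterm (Dfun_cocycle HC HF xc) vl).
- move=> z zc.
  have bz s : s \in Sg cbar -> bd (sev z) s = 0.
    move=> sS; case: (eqVneq #|s| q.+2) => [sq|nq].
      have [i <-] := SIdx_mk sS sq; rewrite -sdelta_bd zc; by rewrite ffunE.
    rewrite (@eq_bd _ _ _ (fun=> 0)) ?bd0 // => t _ ct.
    by rewrite sev_out // -(inj_eq succn_inj) ct (negPf nq) andbF.
  have [xi [xi0 xic [w w0 ew]]] := subdiv_surj HS (sev_set0 z) bz.
  (* [xi] may have components in several degrees; [of_cofun] keeps the one of degree [q]. *)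
  pose x : Cochains k Sg q := of_cofun Sg q (spread cbar Sm xi).
  exists x.
    apply: (isCocycle_of_cofun HC HF) => c fs l b vl.
    rewrite (spread_altdel HC HF Hterm xi0 vl) (eq_spread HF Hterm vl xic).
    by rewrite /spread if_same.
  apply: (isSCobound_bd HS w0) => i; have /andP[sS /eqP sq] := valP i.
  rewrite -ew // sev_val !ffunE; congr (_ - _).
  apply/eqP; rewrite -subr_eq0 -[X in X - _]mul1r; apply/eqP.
  (* Linearity is applied to [res q x - xi], which vanishes on flags with [q.+1] members, so that
     [subdiv_degree] applies. *)
  have := @subdivZD k V (-1) (fun l => -1 * xi l + res q x l) xi (res q x) (val i) (fun=> erefl).
  rewrite (subdiv_degree HS (m := q.+1)) // => [->|xs fx sx]; first by ring.
  suff -> : res q x xs = xi xs by ring.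
  case: xs fx sx => [//|s xs] fx [sx].
  rewrite /res /on_flag ev_of_cofun ?size_pairs ?size_map //; last first.
    exact: (valid_on_flag HF (fs := [::])).
  rewrite -[LHS]/(on_flag Sm (spread cbar Sm xi) cbar [::] (s :: xs)) on_flag_spread //.
  congr xi; rewrite -[RHS]map_id; apply/eq_in_map => t tx.
  rewrite /to_cbar (termor_id HC Hterm) (Sm_id HF) //.
  by case/andP: fx => _ /allP; apply.
Qed.
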